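(* (i) Let $G$ be a triangle-free apex graph on $V \ge 5$ vertices. Then $|E(G)| \le 3V-10$, unless $G$ is isomorphic to the complete bipartite graph $K_{3,V-3}$. (ii) Moreover, let $G$ be an apex graph on $V\ge 7$ vertices with exactly $t$ triangles. Then $|E(G)| \le 3V-9+t/3$.
   Context: All graphs are finite and simple. A graph $G$ is an apex graph if it has a vertex $a$ such that $G-a$ is planar. A triangle of $G$ is a subgraph isomorphic to $K_3$; a graph is triangle-free if it has no triangles. *)

(* Defs.v *)
From HB Require Import structures.
From mathcomp Require Import all_boot all_order all_algebra.
From mathcomp Require Import all_classical all_reals all_analysis.
Set Implicit Arguments.
Unset Strict Implicit.
Unset Printing Implicit Defensive.
Import Order.TTheory GRing.Theory Num.Theory.
Import numFieldNormedType.Exports.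

Local Open Scope classical_set_scope.
Local Open Scope ring_scope.

Record sgraph := SGraph {
  vertex :> finType;
  adj : rel vertex;
  adj_sym : symmetric adj;
  adj_irr : irreflexive adj }.

Definition edges (G : sgraph) : {set {set G}} :=
  [set [set u.1; u.2]%SET | u in [pred u : G * G | adj u.1 u.2]]%SET.

Definition isomorphic (G H : sgraph) : Prop :=
  exists2 f : G -> H, bijective f & forall x y, adj (f x) (f y) = adj x y.

(* A subgraph isomorphic to K_3 is determined by its vertex set, so triangles
   are represented, without repetition, by their vertex sets. *)
Definition triangles (G : sgraph) : {set {set G}} :=
  [set A : {set G} | (#|A| == 3) &&
     [forall x in A, forall y in A, (x != y) ==> adj x y]]%SET.

Definition triangle_free (G : sgraph) : Prop := #|triangles G| = 0%N.

Section DeleteVertex.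
Variables (G : sgraph) (a : G).

Definition del_adj : rel {x : G | x != a} := fun x y => adj (val x) (val y).

Lemma del_adj_sym : symmetric del_adj.
Proof. by move=> x y; apply: adj_sym. Qed.

Lemma del_adj_irr : irreflexive del_adj.
Proof. by move=> x; apply: adj_irr. Qed.

Definition delete_vertex : sgraph := SGraph del_adj_sym del_adj_irr.

End DeleteVertex.

Section CompleteBipartite.
Variables m n : nat.

Definition biclique_adj : rel ('I_m + 'I_n)%type := fun x y =>
  match x, y with
  | inl _, inr _ | inr _, inl _ => true
  | _, _ => false
  end.

Lemma biclique_adj_sym : symmetric biclique_adj.
Proof. by case=> ? []. Qed.

Lemma biclique_adj_irr : irreflexive biclique_adj.
Proof. by case. Qed.

Definition complete_bipartite : sgraph :=
  SGraph biclique_adj_sym biclique_adj_irr.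

End CompleteBipartite.

(* [0, 1] is compact and the plane is Hausdorff, so a continuous injection is
   a homeomorphism onto its image. *)
Definition simple_arc (R : realType) (p q : R * R) (A : set (R * R)) : Prop :=
  exists g : R -> R * R,
    [/\ {within `[0, 1], continuous g},
        {in `[0, 1] &, injective g},
        g 0 = p, g 1 = q & A = g @` `[0, 1]].

(* The arc drawing an edge contains the two endpoints of that edge; the last
   two conditions say that it meets the rest of the drawing nowhere else than
   at these endpoints. *)
Definition plane_drawing (R : realType) (G : sgraph)
    (pos : G -> R * R) (curve : {set G} -> set (R * R)) : Prop :=
  [/\ injective pos,
      forall x y, adj x y -> simple_arc (pos x) (pos y) (curve [set x; y]%SET),
      forall e z, e \in edges G -> curve e (pos z) -> z \in e
    & forall e f, e \in edges G -> f \in edges G -> e != f ->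
        curve e `&` curve f `<=` [set pos z | z in [set` (e :&: f)%SET]]].

(* All models of realType are isomorphic, so planarity does not depend on R. *)
Definition planar (R : realType) (G : sgraph) : Prop :=
  exists pos curve, @plane_drawing R G pos curve.

Definition apex (R : realType) (G : sgraph) : Prop :=
  exists a : G, planar R (delete_vertex a).

(* Main.v *)
From HB Require Import structures.
Require Import Defs.
From mathcomp Require Import all_boot all_order all_algebra.
From mathcomp Require Import zify ring lra.
From mathcomp Require Import all_classical all_reals all_analysis.
Set Implicit Arguments.
Unset Strict Implicit.
Unset Printing Implicit Defensive.
Import Order.TTheory GRing.Theory Num.Theory.
Local Open Scope ring_scope.

(** Let [a] be the apex, [H = G - a], and let [n], [m], [t'] be the numbers of
    vertices, edges and triangles of [H].  Write [d] for the degree of [a],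
    [s = n - d] for the number of vertices of [H] that are not adjacent to [a],
    and [k] for the number of edges of [H] between neighbours of [a]; thus
    [|E(G)| = m + d], and [G] has at least [t' + k] triangles.

    Two consequences of Euler's formula for planar graphs are needed:
    [m <= 3 n - 6], and [2 m <= 4 n - 8 + t'], in which a face boundary of
    length three is charged to a triangle ([maclane_edge_bound] and
    [maclane_triangle_bound]).  The second one gives [2 n - 4] for bipartite
    graphs.

    For the bound with triangles ([apex_triangle_bound]), the claim is
    [3 (m + d) <= 9 n - 18 + t' + k].  Two of the three copies of [m] are
    covered by [2 m <= 4 n - 8 + t'].  In the third one, [m = k + r], where the
    [r] edges that meet a non-neighbour of [a] number at most
    [2 n - 4] (from neighbours to non-neighbours, a bipartite planar graph) plus
    [3 s - 6] (among the non-neighbours).  The sum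
    [4 n - 8 + t' + k + 2 n - 10 + 3 s + 3 d] is exactly the claim.  When
    [s <= 2] the bound [3 s - 6] is not available and [r] is estimated
    directly; this fails only if [s = 2] and the two non-neighbours are adjacent
    and joined to all neighbours of [a], a graph with so many triangles that the
    claim is immediate.

    For the triangle-free bound ([apex_triangle_free_bound]), [k = t' = 0], so
    that [m + d <= 2 n - 4 + d], which is enough when [s >= 3].  When [s <= 2],
    all edges of [G] meet a set of at most three vertices, and the only way to
    exceed the bound is a complete bipartite graph with a side of three.

    The edge bounds must be drawn from arbitrary continuous arcs.  The link
    between topology and counting is MacLane's description of planar graphs
    ([maclane]): every edge has a face on either side, the boundary of any set of
    faces is an even subgraph, and every even subgraph is the boundary of a set
    of faces.  These facts bound the dimension of the cycle space by the number
    of faces ([maclane_count]), which replaces Euler's formula.  They hold for a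
    square grid, where the faces enclosed by an even subgraph are found by
    counting crossings along vertical rays ([torus_closed_boundary]), and they
    are inherited by minors ([minor_maclane]).  By compactness, a plane drawing
    rounded to a fine grid keeps its edges apart outside small disjoint blocks
    around the vertices, so that the drawn graph is a minor of the grid
    ([planar_has_maclane]). *)

(** * Cycle spaces over the two-element field *)

(** Modulo two, loops have no ends and the orientation of the edges is
    irrelevant. *)
Definition inc (V E : finType) (s t : E -> V) (e : E) (x : V) : 'F_2 :=
  (s e == x)%:R + (t e == x)%:R.

Definition closed_chain (V E : finType) (s t : E -> V) (z : E -> 'F_2) :=
  forall x, \sum_e z e * inc s t e x = 0.

Lemma F2_case (a : 'F_2) : a = 0 \/ a = 1.
Proof. by case: a => [[|[|//]] i]; [left|right]; apply: val_inj. Qed.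

Lemma addrr_F2 (a : 'F_2) : a + a = 0.
Proof. by case: (F2_case a) => ->; apply: val_inj. Qed.

Lemma eq_F2 (a b : 'F_2) : a + b = 0 -> a = b.
Proof. by case: (F2_case a) => ->; case: (F2_case b) => ->. Qed.

(** A combinatorial shadow of an embedding in the sphere, after MacLane's
    planarity criterion: [l e] and [r e] are the faces on the two sides of [e],
    and [phi], [w] are indicators of sets of faces.  The second field is the
    algebraic form of the Jordan curve theorem: every even subgraph separates
    the faces into two colours. *)
Record maclane (V E F : finType) (s t : E -> V) (l r : E -> F) : Prop :=
  MacLane {
    boundary_closed : forall phi : F -> 'F_2,
      closed_chain s t (fun e => phi (l e) + phi (r e));
    closed_boundary : forall z, closed_chain s t z ->
      exists w : F -> 'F_2, forall e, z e = w (l e) + w (r e) }.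

Section CycleSpace.
Variables (V E : finType) (s t : E -> V).

Notation chain := {ffun E -> ('F_2)^o}%type.
Notation chain0 := {ffun V -> ('F_2)^o}%type.

Lemma dim_F2_ffun (T : finType) : \dim {: {ffun T -> ('F_2)^o}%type} = #|T|.
Proof. by rewrite dimvf /dim /= muln1. Qed.

Definition bd_fun (z : chain) : chain0 := [ffun x => \sum_e z e * inc s t e x].

Lemma bd_fun_linear : linear bd_fun.
Proof.
move=> a u v; apply/ffunP => x; rewrite !ffunE scaler_sumr -big_split /=.
by apply: eq_bigr => e _; rewrite !ffunE mulrDl scalerAl.
Qed.
HB.instance Definition _ := GRing.isLinear.Build _ _ _ _ bd_fun bd_fun_linear.

Definition bd : 'Hom(chain, chain0) := linfun bd_fun.

Lemma mem_lker_bd (z : chain) : reflect (closed_chain s t z) (z \in lker bd).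
Proof.
rewrite memv_ker lfunE /=; apply: (iffP eqP) => [h x|h].
  by move/ffunP: h => /(_ x); rewrite !ffunE.
by apply/ffunP => x; rewrite !ffunE h.
Qed.

Definition total_fun (u : chain0) : ('F_2)^o := \sum_x u x.

Lemma total_fun_linear : linear total_fun.
Proof.
move=> a u v; rewrite /total_fun scaler_sumr -big_split /=.
by apply: eq_bigr => e _; rewrite !ffunE.
Qed.
HB.instance Definition _ :=
  GRing.isLinear.Build _ _ _ _ total_fun total_fun_linear.

Lemma sum_inc e : \sum_x inc s t e x = 0.
Proof.
rewrite /inc big_split /= -!natr_sum.
have one y : (\sum_x (y == x : nat) = 1)%N.
  by rewrite (bigD1 y) //= eqxx big1 // => x /negPf; rewrite eq_sym => ->.
by rewrite !one addrr_F2.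
Qed.

(** The boundary of an edge has total weight zero, so that the boundary map
    misses some chain as soon as there is a vertex: its rank is at most
    [#|V| - 1]. *)
Lemma dim_cycle_space : (0 < #|V|)%N -> (#|E| < \dim (lker bd) + #|V|)%N.
Proof.
case/card_gt0P => x0 _.
pose tot : 'Hom(chain0, ('F_2)^o) := linfun total_fun.
have sub : (limg bd <= lker tot)%VS.
  apply/subvP => _ /memv_imgP[z _ ->].
  rewrite memv_ker lfunE /= lfunE /= /total_fun.
  under eq_bigr do rewrite ffunE.
  rewrite exchange_big /= big1 // => e _.
  by rewrite -mulr_sumr sum_inc mulr0.
have h1 := limg_ker_dim bd fullv; have h2 := limg_ker_dim tot fullv.
rewrite !capfv !dim_F2_ffun in h1 h2.
have : (0 < \dim (limg tot))%N.
  rewrite lt0n dimv_eq0; apply/eqP => /vspaceP /(_ 1).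
  rewrite memv0 oner_eq0 => /negbT/negP; apply.
  apply/memv_imgP; exists [ffun x => (x == x0)%:R]; first exact: memvf.
  rewrite lfunE /= /total_fun (bigD1 x0) //= ffunE eqxx big1 ?addr0 //.
  by move=> x /negPf h; rewrite ffunE h.
have := dimvS sub; lia.
Qed.

End CycleSpace.

Section MacLaneCount.
Variables (V E F : finType) (s t : E -> V) (l r : E -> F).
Hypothesis ML : maclane s t l r.

Notation chain := {ffun E -> ('F_2)^o}%type.

Definition face_chain (f : F) : chain :=
  [ffun e => (l e == f)%:R + (r e == f)%:R].

Definition supp (z : chain) : {set E} := [set e | z e != 0]%SET.

(** Distinct faces may have the same boundary (both faces of a single cycle,
    for instance), so the boundaries are collected as a set and [mult] keeps
    track of the repetitions. *)
Definition face_chains : {set chain} :=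
  [set B in [set face_chain f | f : F] | B != 0]%SET.

Lemma face_chain_closed f : closed_chain s t (face_chain f).
Proof.
move=> x; rewrite -[RHS](boundary_closed ML (fun g => (g == f)%:R) x).
by apply: eq_bigr => e _; rewrite ffunE.
Qed.

Lemma sum_face_chain (w : F -> 'F_2) :
  \sum_f (w f : 'F_2) *: face_chain f = [ffun e => w (l e) + w (r e)] :> chain.
Proof.
apply/ffunP => e; rewrite sum_ffunE ffunE.
under eq_bigr do rewrite !ffunE /GRing.scale /= mulrDr.
rewrite big_split /=; congr (_ + _).
  rewrite (bigD1 (l e)) //= eqxx mulr1 big1 ?addr0 // => f /negPf.
  by rewrite eq_sym => ->; rewrite mulr0.
rewrite (bigD1 (r e)) //= eqxx mulr1 big1 ?addr0 // => f /negPf.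
by rewrite eq_sym => ->; rewrite mulr0.
Qed.

Lemma cycle_space_spanned (A : {set chain}) :
    (forall f, face_chain f \in <<enum A>>%VS) ->
  (\dim (lker (bd s t)) <= #|A|)%N.
Proof.
move=> h; rewrite cardE; apply: leq_trans (dim_span (enum A)).
apply: dimvS; apply/subvP => z /mem_lker_bd /(closed_boundary ML)[w hw].
have -> : z = \sum_f (w f : 'F_2) *: face_chain f.
  by rewrite sum_face_chain; apply/ffunP => e; rewrite ffunE.
by apply: memv_suml => f _; apply: memvZ.
Qed.

Definition mult (B : chain) := #|[set f | face_chain f == B]%SET|.

Lemma mem_face_chains f : face_chain f != 0 -> face_chain f \in face_chains.
Proof. by move=> h; rewrite !inE h andbT imset_f. Qed.

Lemma dim_face_chains : (\dim (lker (bd s t)) <= #|face_chains|)%N.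
Proof.
apply: cycle_space_spanned => f.
case: (eqVneq (face_chain f) 0) => [->|h]; first exact: mem0v.
by apply: memv_span; rewrite mem_enum mem_face_chains.
Qed.

(** Every edge has two sides, so the boundaries of all faces sum to zero.  A
    boundary that comes from a single face is therefore a combination of the
    other ones, and the cycle space is spanned without it. *)
Lemma dim_face_chains_lt B :
  B \in face_chains -> mult B = 1%N ->
  (\dim (lker (bd s t)) < #|face_chains|)%N.
Proof.
move=> BD /eqP/cards1P[f0 Ef0].
rewrite (cardsD1 B) BD ltnS; apply: cycle_space_spanned.
have other f : f != f0 -> face_chain f \in <<enum (face_chains :\ B)%SET>>%VS.
  move=> ff0; case: (eqVneq (face_chain f) 0) => [->|h]; first exact: mem0v.
  apply: memv_span; rewrite mem_enum in_setD1 mem_face_chains // andbT.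
  apply: contra ff0 => fB; have : f \in [set f0]%SET by rewrite -Ef0 inE.
  by rewrite inE.
move=> f; case: (eqVneq f f0) => [->|]; last exact: other.
have := sum_face_chain (fun _ => 1); rewrite (bigD1 f0) //= scale1r.
have -> : [ffun e => 1 + 1] = 0 :> chain by apply/ffunP => e; rewrite !ffunE; apply: addrr_F2.
move/eqP; rewrite addr_eq0 => /eqP ->; rewrite memvN.
by apply: memv_suml => f1 h; rewrite scale1r; apply: other.
Qed.

(** Each edge is counted at most once for each of its two sides. *)
Lemma sum_supp_mult : (\sum_(B in face_chains) mult B * #|supp B| <= 2 * #|E|)%N.
Proof.
have -> : (\sum_(B in face_chains) mult B * #|supp B| =
          \sum_(f | face_chain f \in face_chains) #|supp (face_chain f)|)%N.
  rewrite (partition_big face_chain (mem face_chains)) //=.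
  apply: eq_bigr => B BD; rewrite /mult -sum1_card big_distrl /=.
  apply: eq_big => [f|f]; first by rewrite inE; case: eqP => [->|]; rewrite ?BD ?andbF ?andbT.
  by rewrite inE => /eqP ->; rewrite mul1n.
apply: (@leq_trans (\sum_f #|supp (face_chain f)|)%N).
  rewrite [X in (_ <= X)%N](bigID (fun f => face_chain f \in face_chains)) /=.
  exact: leq_addr.
under eq_bigr do rewrite -sum1_card big_mkcond /=.
rewrite exchange_big /= mulnC -sum_nat_const; apply: leq_sum => e _.
apply: (@leq_trans (\sum_f ((l e == f) + (r e == f)))%N).
  by apply: leq_sum => f _; rewrite /supp inE ffunE; case: (l e == f); case: (r e == f).
have one g : (\sum_f (g == f : nat) = 1)%N.
  by rewrite (bigD1 g) //= eqxx big1 // => x /negPf; rewrite eq_sym => ->.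
by rewrite big_split /= !one.
Qed.

(** This plays the part of Euler's formula.  If no boundary comes from a single
    face, then the sum of all of them may be the trivial relation, and the first
    inequality is weaker by one; but each edge then lies on at most one of the
    distinct boundaries, and the second inequality is stronger by a factor of
    two. *)
Lemma maclane_count : (0 < #|V|)%N ->
  (#|E| + 2 <= #|face_chains| + #|V| /\
     \sum_(B in face_chains) #|supp B| <= 2 * #|E|)%N \/
  (#|E| + 1 <= #|face_chains| + #|V| /\
     \sum_(B in face_chains) #|supp B| <= #|E|)%N.
Proof.
move=> V0; have h1 := dim_cycle_space s t V0.
have mult0 B : B \in face_chains -> (0 < mult B)%N.
  rewrite !inE => /andP[/imsetP[f _ ->] _].
  by apply/card_gt0P; exists f; rewrite inE.
have [/exists_inP[B BD /eqP mB]|/exists_inPn none] :=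
    boolP [exists B in face_chains, mult B == 1%N].
  left; split; first by have := dim_face_chains_lt BD mB; lia.
  apply: leq_trans sum_supp_mult; apply: leq_sum => C /mult0; nia.
right; split; first by have := dim_face_chains; lia.
rewrite -(leq_pmul2l (ltn0Sn 1)) big_distrr /=.
apply: leq_trans sum_supp_mult; apply: leq_sum => C CD.
by rewrite leq_mul2r; have := mult0 _ CD; have := none _ CD; lia.
Qed.

End MacLaneCount.

(** * Edge bounds for graphs with a MacLane structure *)

Definition edge_type (G : sgraph) : finType := {e : {set G} | e \in edges G}.

Definition has_maclane (G : sgraph) : Prop :=
  exists (F : finType) (s t : edge_type G -> G) (l r : edge_type G -> F),
    (forall e, val e = [set s e; t e]%SET) /\ maclane s t l r.

Section SimpleGraph.
Variable G : sgraph.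

Lemma edgesP (e : {set G}) :
  reflect (exists x y, adj x y /\ e = [set x; y]%SET) (e \in edges G).
Proof.
apply: (iffP imsetP) => [[[x y]] /= h ->|[x [y [h ->]]]]; first by exists x, y.
by exists (x, y).
Qed.

Lemma adj_neq (x y : G) : adj x y -> x != y.
Proof. by apply: contraTneq => ->; rewrite adj_irr. Qed.

Lemma mem_edges (x y : G) : ([set x; y]%SET \in edges G) = adj x y.
Proof.
apply/edgesP/idP => [[u [v [uv E]]]|h]; last by exists x, y.
have xu : x \in [set u; v]%SET by rewrite -E set21.
have yu : y \in [set u; v]%SET by rewrite -E set22.
have nxy : x != y.
  apply: contraTneq (adj_neq uv) => xy; move: (congr1 (fun A : {set G} => #|A|) E).
  by rewrite xy finset.setUid cards1 cards2; case: (u =P v).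
move: xu yu nxy; rewrite !inE => /orP[]/eqP -> /orP[]/eqP ->; rewrite ?eqxx //.
by rewrite adj_sym.
Qed.

Lemma card_edge_type : #|edge_type G| = #|edges G|.
Proof. by rewrite card_sig; apply: eq_card => e. Qed.

Variables (s t : edge_type G -> G).
Hypothesis st : forall e, val e = [set s e; t e]%SET.

Lemma incE e x : inc s t e x = (x \in val e)%:R.
Proof.
have : s e != t e by apply: adj_neq; rewrite -mem_edges -st; apply: valP.
rewrite /inc st !inE ![x == _]eq_sym => ne.
case: (s e =P x) ne => [->|_] ne; last by rewrite add0r.
by rewrite eq_sym (negPf ne) addr0.
Qed.

Section Closed.
Variable z : {ffun edge_type G -> ('F_2)^o}%type.
Hypothesis zc : closed_chain s t z.

(** A closed chain has even degree at every vertex. *)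
Lemma closed_next e x : e \in supp z -> x \in val e ->
  exists e', [/\ e' \in supp z, e' != e & x \in val e'].
Proof.
move=> ez xe.
have [/existsP[e' /and3P[*]]|/existsPn no] :=
  boolP [exists e', [&& e' \in supp z, e' != e & x \in val e']].
  by exists e'.
have := zc x; rewrite (bigD1 e) //= big1 ?addr0 => [|e' ne].
  rewrite incE xe mulr1 => ze; move: ez.
  by rewrite /supp inE ze eqxx.
have := no e'; rewrite /supp inE ne incE.
by case: eqP => [->|_]; [rewrite mul0r|case: (x \in _); rewrite ?mulr0].
Qed.

Lemma edge_other (e : edge_type G) x : x \in val e -> exists2 y, y != x & val e = [set x; y]%SET.
Proof.
have := valP e => /edgesP[u [v [/adj_neq uv ->]]]; rewrite !inE.
case/orP => /eqP ->; [exists v => // | exists u => //]; first by rewrite eq_sym.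
by rewrite finset.setUC.
Qed.

(** Starting from one edge [xy] of the chain, evenness at [y] gives a second
    edge [yw], and evenness at [w] a third one; if there are no others, evenness
    at [x] forces the third one to be [wx].  Since the last clause recovers the
    chain from the vertex set [T], different chains of length three yield
    different triangles. *)
Lemma closed_supp : z != 0 ->
  (3 < #|supp z|)%N \/
  exists T, [/\ T \in triangles G, #|supp z| = 3%N &
                supp z = [set e : edge_type G | val e \subset T]%SET].
Proof.
move=> /eqP z0.
have [e1 e1z] : exists e, e \in supp z.
  apply/existsP; apply/existsPn => h; apply: z0; apply/ffunP => e; rewrite ffunE.
  by have := h e; rewrite /supp inE negbK => /eqP.
have [x [y [xy E1]]] := elimT (edgesP _) (valP e1).
have nxy := adj_neq xy.
have [|e2 [e2z n21 ye2]] := closed_next (x := y) e1z; first by rewrite E1 set22.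
have [w nwy E2] := edge_other ye2.
have nwx : w != x.
  apply: contraNneq n21 => wx; apply/eqP/val_inj.
  by rewrite E1 E2 wx finset.setUC.
have [|e3 [e3z n32 we3]] := closed_next (x := w) e2z; first by rewrite E2 set22.
have n31 : e3 != e1.
  by apply: contraTneq we3 => ->; rewrite E1 !inE (negPf nwx) (negPf nwy).
have c3 : #|[set e1; e2; e3]%SET| = 3%N.
  rewrite finset.setUC cardsU1 cards2 !inE (negPf n31) (negPf n32) eq_sym n21 //.
have sub : [set e1; e2; e3]%SET \subset supp z.
  by apply/fintype.subsetP => e; rewrite !inE => /orP[/orP[]|] /eqP ->; move: e1z e2z e3z; rewrite /supp !inE.
have := subset_leq_card sub; rewrite c3 leq_eqVlt => /orP[/eqP eq3|]; last by left.
right.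
have Ez : supp z = [set e1; e2; e3]%SET.
  by apply/esym/eqP; rewrite eqEcard sub c3 -eq3.
have xe3 : x \in val e3.
  have [|e [ez ne1 xe]] := closed_next (x := x) e1z; first by rewrite E1 set21.
  move: ez xe; rewrite Ez !inE (negPf ne1) /= => /orP[/eqP ->|/eqP -> //].
  by rewrite E2 !inE (negPf nxy) eq_sym (negPf nwx).
have [v nvw E3'] := edge_other we3.
have E3 : val e3 = [set w; x]%SET.
  move: xe3; rewrite E3' !inE eq_sym (negPf nwx) /= => /eqP ->; done.
have yw : adj y w by rewrite -mem_edges -E2; apply: valP.
have wx : adj w x by rewrite -mem_edges -E3; apply: valP.
exists [set x; y; w]%SET; split=> //.
- rewrite inE; apply/andP; split.
    by rewrite finset.setUC cardsU1 cards2 !inE nxy (negPf nwx) (negPf nwy).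
  apply/forall_inP => a; rewrite !inE -orbA => aT.
  apply/forall_inP => b; rewrite !inE -orbA => bT; apply/implyP.
  case/or3P: aT => /eqP->; case/or3P: bT => /eqP->; rewrite ?eqxx //.
  + by rewrite adj_sym.
  + by rewrite adj_sym.
  + by rewrite adj_sym.
- apply/setP => e; rewrite Ez !inE.
  apply/idP/idP => [|/fintype.subsetP h].
    case/orP=> [/orP[]|] /eqP->; rewrite ?E1 ?E2 ?E3; apply/fintype.subsetP => a;
      by rewrite !inE => /orP[]/eqP->; rewrite eqxx ?orbT.
  have [a [b [ab E]]] := elimT (edgesP _) (valP e).
  have := h a; have := h b; rewrite E set21 set22 !inE -!orbA.
  have nab := adj_neq ab.
  have ee e' : val e = val e' -> e == e' by move=> h'; apply/eqP/val_inj.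
  move=> /(_ isT)/or3P[]/eqP Eb /(_ isT)/or3P[]/eqP Ea; move: nab E; rewrite Ea Eb ?eqxx // => _ E.
  + by rewrite (ee e1) // E E1 finset.setUC.
  + by rewrite (ee e3) ?orbT // E E3.
  + by rewrite (ee e1) // E E1.
  + by rewrite (ee e2) ?orbT // E E2 finset.setUC.
  + by rewrite (ee e3) ?orbT // E E3 finset.setUC.
  + by rewrite (ee e2) ?orbT // E E2.
Qed.

End Closed.

Variables (F : finType) (l r : edge_type G -> F).
Hypothesis ML : maclane s t l r.

Notation D := (face_chains l r).

Lemma face_chainsP B : B \in D -> closed_chain s t B /\ B != 0.
Proof.
rewrite inE => /andP[/imsetP[f _ ->] ->]; split=> //.
exact: face_chain_closed ML f.
Qed.

Lemma three_face_chains : (3 * #|D| <= \sum_(B in D) #|supp B|)%N.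
Proof.
rewrite mulnC -sum_nat_const; apply: leq_sum => B /face_chainsP[Bc B0].
by case: (closed_supp Bc B0) => [/ltnW //|[T [_ -> _]]].
Qed.

(** All boundaries have length four or more, except those that are
    triangles, and these are charged to different triangles of [G]. *)
Lemma four_face_chains :
  (4 * #|D| <= \sum_(B in D) #|supp B| + #|triangles G|)%N.
Proof.
pose D3 := [set B in D | #|supp B| == 3%N]%SET.
have D3t : (#|D3| <= #|triangles G|)%N.
  have tri B : B \in D3 -> exists T, T \in triangles G /\
      supp B = [set e : edge_type G | val e \subset T]%SET.
    rewrite inE => /andP[/face_chainsP[Bc B0] /eqP B3].
    case: (closed_supp Bc B0) => [|[T [TG _ BT]]]; first by rewrite B3.
    by exists T.
  pose f B := odflt finset.set0 [pick T in triangles G | supp B == [set e : edge_type G | val e \subset T]%SET].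
  have fP B : B \in D3 -> f B \in triangles G /\ supp B = [set e : edge_type G | val e \subset f B]%SET.
    move=> /tri[T [TG BT]]; rewrite /f; case: pickP => [T' /andP[? /eqP]|/(_ T)] //=.
    by rewrite TG BT eqxx.
  rewrite -(card_in_imset (f := f)).
    by apply: subset_leq_card; apply/fintype.subsetP => _ /imsetP[B /fP[? _] ->].
  move=> A B /fP[_ hA] /fP[_ hB] AB; apply/ffunP => e.
  have : supp A = supp B by rewrite hA hB AB.
  move/setP/(_ e); rewrite /supp !inE.
  by case: (F2_case (A e)) => ->; case: (F2_case (B e)) => ->.
rewrite mulnC -sum_nat_const.
apply: (@leq_trans (\sum_(B in D) (#|supp B| + (#|supp B| == 3%N)))%N).
  apply: leq_sum => B /face_chainsP[Bc B0].
  case: (closed_supp Bc B0) => [h|[T [_ -> _]]] //.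
  by rewrite (leq_trans h) ?leq_addr.
rewrite big_split /= leq_add2l (leq_trans _ D3t) //.
rewrite /D3 -sum1_card [X in (_ <= X)%N](eq_bigl (fun B => (B \in D) && (#|supp B| == 3%N))).
  by rewrite big_mkcondr /=; apply: leq_sum => B _; case: eqP.
by move=> B; rewrite inE.
Qed.

End SimpleGraph.

Lemma maclane_edge_bound (G : sgraph) : has_maclane G -> (3 <= #|G|)%N ->
  (#|edges G| + 6 <= 3 * #|G|)%N.
Proof.
move=> [F [s [t [l [r [st ML]]]]]] n3.
have := three_face_chains st ML; rewrite -card_edge_type.
have [|[]|[]] := maclane_count ML; lia.
Qed.

Lemma maclane_triangle_bound (G : sgraph) : has_maclane G -> (4 <= #|G|)%N ->
  (2 * #|edges G| + 8 <= 4 * #|G| + #|triangles G|)%N.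
Proof.
move=> [F [s [t [l [r [st ML]]]]]] n3.
have := four_face_chains st ML; rewrite -card_edge_type.
have [|[]|[]] := maclane_count ML; lia.
Qed.

(** * The grid on the torus *)

Section Torus.
Variable n : nat.
Notation K := 'I_n.+2.
Notation Q := (K * K)%type.

(** The grid is wrapped into a torus, so that all vertices look alike.  The
    edge [(b, q)] leads from [q] to [q + dir b], and a unit square is named by its
    corner with the smallest coordinates. *)
Definition dir (b : bool) : Q := if b then (0, 1) else (1, 0).
Definition torus_s (e : bool * Q) : Q := e.2.
Definition torus_t (e : bool * Q) : Q := e.2 + dir e.1.
Definition torus_l (e : bool * Q) : Q := if e.1 then e.2 - dir false else e.2.
Definition torus_r (e : bool * Q) : Q := if e.1 then e.2 else e.2 - dir true.

Lemma torus_sum_inc (z : bool * Q -> 'F_2) x :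
  \sum_e z e * inc torus_s torus_t e x =
  z (false, x) + z (false, x - dir false) + (z (true, x) + z (true, x - dir true)).
Proof.
have one b : \sum_q z (b, q) * inc torus_s torus_t (b, q) x =
    z (b, x) + z (b, x - dir b).
  under eq_bigr do rewrite /inc mulrDr.
  rewrite big_split /=; congr (_ + _).
    rewrite (bigD1 x) //= eqxx mulr1 big1 ?addr0 // => q /negPf.
    by rewrite /torus_s => ->; rewrite mulr0.
  rewrite (bigD1 (x - dir b)) //= /torus_t subrK eqxx mulr1 big1 ?addr0 // => q.
  by rewrite -subr_eq0 opprB addrA subr_eq0 => /negPf ->; rewrite mulr0.
rewrite (eq_bigr (fun p => z (p.1, p.2) * inc torus_s torus_t (p.1, p.2) x));
  last by case.
rewrite -(pair_bigA _ (fun b q => z (b, q) * inc torus_s torus_t (b, q) x)) /=.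
by rewrite big_bool /= !one addrC.
Qed.

Lemma torus_boundary_closed (phi : Q -> 'F_2) :
  closed_chain torus_s torus_t (fun e => phi (torus_l e) + phi (torus_r e)).
Proof.
move=> x; rewrite torus_sum_inc /torus_l /torus_r /=.
rewrite [x - dir true - _]addrAC.
set a := phi x; set b := phi _; set c := phi _; set d := phi _.
by case: (F2_case a) => ->; case: (F2_case b) => ->; case: (F2_case c) => ->;
  case: (F2_case d) => ->; apply/val_inj.
Qed.

(** The value [w q] is the parity of the number of horizontal edges of [z]
    above the square [q].  Moving down across a horizontal edge changes this
    number by that edge; moving sideways across a vertical edge [e] changes it by
    the horizontal edges at the vertices above [e], and evenness of [z] at these
    vertices reduces their sum to [z e].  Non-contractible cycles of the torus are
    not boundaries, whence the condition that [z] avoids the row and the column of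
    coordinate zero: [w] then vanishes along them, which is where the torus closes up. *)
Lemma torus_closed_boundary (z : bool * Q -> 'F_2) :
    closed_chain torus_s torus_t z ->
    (forall e, z e != 0 -> [/\ (torus_s e).1 != 0, (torus_s e).2 != 0,
       (torus_t e).1 != 0 & (torus_t e).2 != 0]) ->
  exists w : Q -> 'F_2, forall e, z e = w (torus_l e) + w (torus_r e).
Proof.
move=> zc zI.
pose w (q : Q) : 'F_2 := \sum_(k : K | (q.2 < k)%N) z (false, (q.1, k)).
have z0 b (q : Q) : [|| q.1 == 0, q.2 == 0, (q + dir b).1 == 0 | (q + dir b).2 == 0] ->
    z (b, q) = 0.
  move=> h; apply/eqP; apply: contraLR h => /zI[]; rewrite /torus_s /torus_t /=.
  by move=> /negPf -> /negPf -> /negPf -> /negPf ->.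
have max0 : (ord_max : K) + 1 = 0 by apply: val_inj; rewrite /= addn1 modnn.
have predK (j : K) : j != 0 -> val (j - 1) = (val j).-1.
  move=> j0; have jp : (0 < val j)%N by rewrite lt0n.
  have -> : j = inord (val j).-1 + 1.
    apply: val_inj; rewrite /= inordK ?(ltn_trans _ (ltn_ord j)) ?prednK //.
    by rewrite modnDmr addn1 prednK // modn_small.
  rewrite addrK /= inordK; last by rewrite (leq_ltn_trans (leq_pred _)).
  by rewrite modnDmr addn1 prednK // modn_small.
have wH i (j : K) : j != 0 -> w (i, j - 1) = w (i, j) + z (false, (i, j)).
  move=> j0; have jp : (0 < val j)%N by rewrite lt0n.
  have lt1 k : ((i, (j - 1)%R).2 < k)%N = (j <= k)%N.
    by have := predK _ j0; rewrite -[(i, j - 1).2]/(j - 1) => ->; rewrite prednK.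
  transitivity (\sum_(k : K | (j <= k)%N) z (false, (i, k))).
    by apply: eq_bigl => k; exact: lt1.
  rewrite (bigD1 j) // addrC; congr (_ + _).
  by apply: eq_bigl => k; rewrite /= ltn_neqAle andbC eq_sym.
have wtop i : w (i, ord_max) = 0.
  by rewrite /w big1 // => k /=; rewrite ltnNge -ltnS ltn_ord.
(* Downward induction on the height [j], starting at the top row. *)
have wV (m : nat) (i j : K) : (val j + m = n.+1)%N ->
    w (i - 1, j) + w (i, j) = z (true, (i, j)).
  elim: m j => [|m IH] j jm.
    have -> : j = ord_max by apply: val_inj; move: jm; rewrite addn0.
    have top : (i, ord_max : K) + dir true = (i + 0, 0) by congr pair; exact: max0.
    by rewrite !wtop addr0 z0 // top eqxx !orbT.
  have j1 : val (j + 1) = (val j).+1 by move: jm => /= jm; rewrite modnDmr addn1 modn_small //; lia.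
  have j10 : j + 1 != 0 by rewrite -val_eqE j1.
  have /IH : (val (j + 1)%R + m = n.+1)%N by rewrite j1; lia.
  have := wH i _ j10; have := wH (i - 1) _ j10; rewrite addrK => -> ->.
  have := zc (i, j + 1); rewrite torus_sum_inc.
  have -> : (i, j + 1) - dir false = (i - 1, j + 1).
    by congr pair; rewrite /= subr0.
  have -> : (i, j + 1) - dir true = (i, j).
    by congr pair; rewrite /= ?subr0 ?addrK.
  move: (w _) (w _) (z _) (z _) (z _) (z _) => a b c d e f.
  move/eq_F2 => h1 h2.
  by rewrite addrACA h2 [e + f]addrC h1 addrA addrr_F2 add0r.
have wbot (m : nat) (i : K) : val i = m -> w (i, 0) = 0.
  elim: m i => [|m IH] i im.
    have -> : i = 0 by apply: val_inj.
    by rewrite /w big1 // => k _; rewrite z0 // eqxx.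
  have i0 : i != 0 by rewrite -val_eqE im.
  have := wV n.+1 i 0 (add0n _); rewrite z0 ?eqxx ?orbT // => /eq_F2 <-.
  by apply: IH; rewrite predK // im.
exists w => -[[] [i j]].
  have -> : torus_l (true, (i, j)) = (i - 1, j) by congr pair; rewrite /= subr0.
  by rewrite (wV (n.+1 - j)%N) //; have := ltn_ord j; rewrite /=; lia.
have -> : torus_r (false, (i, j)) = (i, j - 1) by congr pair; rewrite /= subr0.
have -> : torus_l (false, (i, j)) = (i, j) by [].
case: (eqVneq j 0) => [->|j0]; last by rewrite wH // addrA addrr_F2 add0r.
rewrite -[X in (i, X - 1)]max0 addrK wtop (wbot (val i)) // z0 ?addr0 //.
by rewrite eqxx orbT.
Qed.

End Torus.

(** * MacLane structures and minors *)

Section Minor.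
Variables (Q EQ FQ : finType) (sQ tQ : EQ -> Q) (lQ rQ : EQ -> FQ).
Variables (V E : finType) (s t : E -> V).
Variables (lab : Q -> option V) (c : V -> Q) (star : E -> EQ).

(** The labels sort the vertices of the host graph into branch sets.  The
    edges inside a branch set are contracted, the edges [star e] survive as the
    edges of the minor, and all other edges are deleted. *)
Definition inner (e : EQ) := (lab (sQ e) == lab (tQ e)) && (lab (sQ e) != None).

Definition inner_rel : rel Q := fun a b =>
  [exists e, inner e && (((sQ e, tQ e) == (a, b)) || ((sQ e, tQ e) == (b, a)))].

(** The chain is the sum modulo two of the edges of a path. *)
Lemma connect_chain a b : connect inner_rel a b ->
  exists z : EQ -> 'F_2, (forall e, ~~ inner e -> z e = 0) /\
    forall q, \sum_e z e * inc sQ tQ e q = (a == q)%:R + (b == q)%:R.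
Proof.
case/connectP => p; elim: p a => [|a' p IH] a /=.
  move=> _ ->; exists (fun _ => 0); split=> // q.
  by rewrite addrr_F2 big1 // => e _; rewrite mul0r.
case/andP => /existsP[e /andP[ie eaa']] /IH{}IH /IH[z [z0 zb]].
exists (fun e' => (e' == e)%:R + z e'); split=> [e' ne'|q].
  by rewrite z0 // addr0; case: eqP ne' => // ->; rewrite ie.
under eq_bigr do rewrite mulrDl.
rewrite big_split /= zb (bigD1 e) //= eqxx mul1r big1 ?addr0; last first.
  by move=> e' /negPf ->; rewrite mul0r.
have -> : inc sQ tQ e q = (a == q)%:R + (a' == q)%:R.
  by case/orP: eaa' => /eqP[<- <-] //; rewrite /inc addrC.
by rewrite addrA -[X in X + _]addrA addrr_F2 addr0.
Qed.

Hypothesis host_boundary : forall phi : FQ -> 'F_2,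
  closed_chain sQ tQ (fun e => phi (lQ e) + phi (rQ e)).
Hypothesis host_closed : forall z : EQ -> 'F_2, closed_chain sQ tQ z ->
  (forall e, z e != 0 -> lab (sQ e) != None /\ lab (tQ e) != None) ->
  exists w : FQ -> 'F_2, forall e, z e = w (lQ e) + w (rQ e).
Hypothesis branch_connected : forall x q, lab q = Some x ->
  connect inner_rel (c x) q.
Hypothesis star_inj : injective star.
Hypothesis star_lab : forall e,
  (lab (sQ (star e)) = Some (s e) /\ lab (tQ (star e)) = Some (t e)) \/
  (lab (sQ (star e)) = Some (t e) /\ lab (tQ (star e)) = Some (s e)).
Hypothesis no_loop : forall e, s e != t e.

Lemma star_outer e : ~~ inner (star e).
Proof.
have := no_loop e; rewrite /inner.
case: (star_lab e) => [[-> ->]|[-> ->]]; rewrite andbT /= => h;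
  by apply: contra h => /eqP[->].
Qed.

Definition kept (e : EQ) := inner e || (e \in codom star).

(** Deleting an edge unites the faces on its two sides. *)
Definition merge_rel : rel FQ := fun f g =>
  [exists e, ~~ kept e && (((lQ e, rQ e) == (f, g)) || ((lQ e, rQ e) == (g, f)))].

Lemma merge_sym : connect_sym merge_rel.
Proof.
by apply: sym_connect_sym => f g; apply: eq_existsb => e; rewrite orbC.
Qed.

Notation merged := (fingraph.root merge_rel).

Lemma merged_unkept e : ~~ kept e -> merged (lQ e) = merged (rQ e).
Proof.
move=> ke; apply/(fingraph.rootP merge_sym)/connect1/existsP.
by exists e; rewrite ke eqxx.
Qed.

Lemma merged_const (w : FQ -> 'F_2) :
  (forall e, ~~ kept e -> w (lQ e) = w (rQ e)) ->
  forall f, w (merged f) = w f.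
Proof.
move=> h f; have /connectP[p pp ->] := connect_root merge_rel f.
elim: p f pp => //= g p IH f /andP[/existsP[e /andP[ke fg]] /IH ->].
by case/orP: fg => /eqP[<- <-]; rewrite h.
Qed.

(** Faces of the minor are classes of faces of the host.  For the first
    property, the boundary of a union of classes contains no deleted edge, and
    summing its evenness over a branch set cancels the inner edges, leaving the
    edges of the minor.  For the second one, an even chain of the minor is lifted
    to the host by completing each [star e] with paths inside the branch sets of
    its ends; the lift is a boundary in the host, and its two-colouring of the
    faces is constant on classes because the lift contains no deleted edge. *)
Lemma minor_maclane :
  maclane s t (fun e => merged (lQ (star e))) (fun e => merged (rQ (star e))).
Proof.
split=> [phi x|z zc].
  pose Z e := phi (merged (lQ e)) + phi (merged (rQ e)).
  pose ends e : 'F_2 := (lab (sQ e) == Some x)%:R + (lab (tQ e) == Some x)%:R.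
  have ends_star e : ends (star e) = inc s t e x.
    by rewrite /ends /inc; case: (star_lab e) => -[-> ->] //; rewrite addrC.
  transitivity (\sum_e Z e * ends e).
    rewrite (bigID (mem (codom star))) /= [X in _ + X]big1 ?addr0.
      rewrite [RHS](eq_bigl (fun e => e \in star @: [set: E])%SET); last first.
        by move=> e; apply/codomP/imsetP => [[e' ->]|[e' _ ->]]; exists e'.
      rewrite big_imset /=; last by move=> ? ? _ _; apply: star_inj.
      by apply: eq_big => [e|e _]; rewrite ?inE ?ends_star.
    move=> e ne; case: (boolP (inner e)) => [/andP[/eqP ie _]|ie].
      by rewrite /ends ie addrr_F2 mulr0.
    by rewrite /Z merged_unkept ?addrr_F2 ?mul0r // /kept negb_or ie.
  have hc := host_boundary (fun f => phi (merged f)).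
  transitivity (\sum_(q | lab q == Some x) \sum_e Z e * inc sQ tQ e q); last first.
    by apply: big1 => q _; apply: hc.
  rewrite exchange_big /=; apply: eq_bigr => e _.
  rewrite -mulr_sumr; congr (_ * _); rewrite /inc big_split /=.
  have one a : \sum_(q | lab q == Some x) (a == q)%:R = (lab a == Some x)%:R :> 'F_2.
    case: (boolP (lab a == Some x)) => h.
      rewrite (bigD1 a) //= eqxx big1 ?addr0 // => q /andP[_ /negPf].
      by rewrite eq_sym => ->.
    by rewrite big1 // => q hq; case: (a =P q) h => // ->; rewrite hq.
  by rewrite !one.
(* The lift of an edge of the minor. *)
have pathE e : {p : EQ -> 'F_2 |
    (forall e', ~~ inner e' -> p e' = (e' == star e)%:R) /\
    (forall q, \sum_e' p e' * inc sQ tQ e' q =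
       (c (s e) == q)%:R + (c (t e) == q)%:R)}.
  apply: cid.
  have ext a b x y : lab a = Some x -> lab b = Some y ->
      (forall q, inc sQ tQ (star e) q = (a == q)%:R + (b == q)%:R) ->
    exists p : EQ -> 'F_2,
    (forall e', ~~ inner e' -> p e' = (e' == star e)%:R) /\
    (forall q, \sum_e' p e' * inc sQ tQ e' q =
       (c x == q)%:R + (c y == q)%:R).
    move=> /branch_connected/connect_chain[z1 [z10 b1]].
    move=> /branch_connected/connect_chain[z2 [z20 b2]] ab.
    exists (fun e' => z1 e' + z2 e' + (e' == star e)%:R); split=> [e' ie'|q].
      by rewrite z10 // z20 // !add0r.
    under eq_bigr do rewrite !mulrDl.
    rewrite !big_split /= b1 b2 (bigD1 (star e)) //= eqxx mul1r ab big1; last first.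
      by move=> e' /negPf ->; rewrite mul0r.
    rewrite addr0; move: (_ == q) (_ == q) (_ == q) (_ == q) => [] [] [] [];
    by apply/val_inj.
  case: (star_lab e) => -[h1 h2]; first by apply: (ext _ _ _ _ h1 h2).
  by apply: (ext _ _ _ _ h2 h1) => q; rewrite /inc addrC.
pose Z e' := \sum_e z e * sval (pathE e) e'.
have Zstar e : Z (star e) = z e.
  rewrite /Z (bigD1 e) //= big1 => [|e' ne'].
    by case: (pathE e) => p /= [h _]; rewrite (h _ (star_outer e)) eqxx mulr1 addr0.
  case: (pathE e') => p /= [h _]; rewrite (h _ (star_outer e)).
  by rewrite (inj_eq star_inj) eq_sym (negPf ne') mulr0.
have Zunkept e' : ~~ kept e' -> Z e' = 0.
  rewrite /kept negb_or => /andP[ie' ce']; rewrite /Z big1 // => e _.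
  case: (pathE e) => p /= [h _]; rewrite (h _ ie').
  by case: eqP ce' => [->|_]; rewrite ?codom_f // mulr0.
have Zc : closed_chain sQ tQ Z.
  move=> q; rewrite /Z.
  under eq_bigr do rewrite mulr_suml.
  rewrite exchange_big /=.
  have st e : \sum_x inc s t e x * (c x == q)%:R = (c (s e) == q)%:R + (c (t e) == q)%:R.
    rewrite /inc; under eq_bigr do rewrite mulrDl.
    rewrite big_split /=; congr (_ + _).
      rewrite (bigD1 (s e)) //= eqxx mul1r big1 ?addr0 // => x /negPf.
      by rewrite eq_sym => ->; rewrite mul0r.
    rewrite (bigD1 (t e)) //= eqxx mul1r big1 ?addr0 // => x /negPf.
    by rewrite eq_sym => ->; rewrite mul0r.
  transitivity (\sum_e \sum_x z e * inc s t e x * (c x == q)%:R).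
    apply: eq_bigr => e _.
    under eq_bigr do rewrite -mulrA.
    case: (pathE e) => p /= [_ ph]; rewrite -mulr_sumr ph -st mulr_sumr.
    by apply: eq_bigr => x _; rewrite mulrA.
  rewrite exchange_big big1 //= => x _.
  by rewrite -mulr_suml zc mul0r.
have [|w hw] := host_closed Zc.
  move=> e' Ze'; have : kept e' by apply: contraNT Ze' => /Zunkept ->.
  case/orP => [/andP[/eqP <- ->] //|/codomP[e ->]].
  by case: (star_lab e) => -[-> ->].
have wc := @merged_const w; exists w => e.
rewrite !wc -?hw ?Zstar // => e' /Zunkept; rewrite hw => /eq_F2 //.
Qed.

End Minor.

(** * Graphs routed on a grid *)

Definition grid_adj (p q : nat * nat) : bool :=
  [|| q == (p.1.+1, p.2), q == (p.1, p.2.+1),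
      p == (q.1.+1, q.2) | p == (q.1, q.2.+1)]%N.

(** The distance of the sup norm, for which balls are square blocks. *)
Definition grid_near (k : nat) (p q : nat * nat) : bool :=
  [&& p.1 <= q.1 + k, q.1 <= p.1 + k, p.2 <= q.2 + k & q.2 <= p.2 + k]%N.

(** A picture of [G] on the grid: a block of radius [rho] around a centre [c v]
    stands for the vertex [v], and a walk [W e] between the centres of the two
    ends stands for the edge [e].  Walks may pause, repeat cells, and cross each
    other inside blocks. *)
Section LatticeModel.
Variables (G : sgraph) (s t : edge_type G -> G).
Hypothesis st : forall e, val e = [set s e; t e]%SET.
Variables (n rho : nat) (c : G -> nat * nat).
Variables (len : edge_type G -> nat) (W : edge_type G -> nat -> nat * nat).

Definition in_grid (q : nat * nat) : bool := (0 < q.1 <= n.+1)%N && (0 < q.2 <= n.+1)%N.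
Notation block v q := (grid_near rho (c v) q).

Hypothesis block_in : forall v q, block v q -> in_grid q.
Hypothesis W_in : forall e k, in_grid (W e k).
Hypothesis W0 : forall e, W e 0 = c (s e).
Hypothesis Wlen : forall e, W e (len e) = c (t e).
Hypothesis Wstep : forall e k, W e k = W e k.+1 \/ grid_adj (W e k) (W e k.+1).
Hypothesis blocks_disjoint : forall u v q, block u q -> block v q -> u = v.
Hypothesis W_block : forall e k w, (k <= len e)%N -> block w (W e k) -> w = s e \/ w = t e.
Hypothesis W_disjoint : forall e f k j, (k <= len e)%N -> (j <= len f)%N ->
  W e k = W f j -> e = f \/ exists w, block w (W e k).

Lemma block_center v : block v (c v).
Proof. by rewrite /grid_near !leq_addr. Qed.

Lemma ends_neq e : s e != t e.
Proof. by apply: adj_neq; rewrite -mem_edges -st; apply: valP. Qed.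

Lemma entry_exists e : exists k, block (t e) (W e k).
Proof. by exists (len e); rewrite Wlen block_center. Qed.

Definition entry e := ex_minn (entry_exists e).

Lemma entry_block e : block (t e) (W e (entry e)).
Proof. by rewrite /entry; case: ex_minnP. Qed.

Lemma entry_le e : (entry e <= len e)%N.
Proof. by rewrite /entry; case: ex_minnP => k _; apply; rewrite Wlen block_center. Qed.

Lemma before_entry e k : (k < entry e)%N -> ~~ block (t e) (W e k).
Proof.
rewrite /entry; case: ex_minnP => m _ h km; apply/negP => /h.
by rewrite leqNgt km.
Qed.

Lemma entry_gt0 e : (0 < entry e)%N.
Proof.
rewrite lt0n; apply/eqP => e0; have := entry_block e; rewrite e0 W0 => h.
have := ends_neq e; rewrite (blocks_disjoint (block_center (s e)) h).
by rewrite eqxx.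
Qed.

Definition tail_cell e q := [exists k : 'I_(entry e), W e k == q].

(** The branch set of [v] is its block together with the initial parts,
    up to the first entry into the block of [t e], of the walks of the edges [e]
    with [s e = v].  The step of [W e] that enters the block of [t e] then
    represents [e]. *)
Definition grid_label (q : nat * nat) : option G :=
  [pick v | block v q || [forall w, ~~ block w q] &&
      [exists e, (s e == v) && tail_cell e q]].

Lemma grid_label_block v q : block v q -> grid_label q = Some v.
Proof.
rewrite /grid_label => vq; case: pickP => [u|/(_ v)]; last by rewrite vq.
case/orP => [uq|/andP[/forallP/(_ v)]]; last by rewrite vq.
by rewrite (blocks_disjoint uq vq).
Qed.

(** Before the entry, a cell of the walk in a block can only be in the
    block of [s e]; outside the blocks, no other walk passes. *)
Lemma grid_label_tail e k : (k < entry e)%N -> grid_label (W e k) = Some (s e).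
Proof.
move=> ke; have kl : (k <= len e)%N by apply: leq_trans (ltnW ke) (entry_le e).
have [/existsP[w wk]|/existsPn nb] := boolP [exists w, block w (W e k)].
  case: (W_block kl wk) => E; subst w; first exact: grid_label_block.
  by have := before_entry ke; rewrite wk.
have te : tail_cell e (W e k) by apply/existsP; exists (Ordinal ke).
rewrite /grid_label; case: pickP => [u|/(_ (s e))]; last first.
  have -> /= : [forall w, ~~ block w (W e k)] by apply/forallP.
  by move/negbT; rewrite negb_or => /andP[_ /existsPn/(_ e)]; rewrite eqxx te.
rewrite (negPf (nb u)) /= => /andP[_ /existsP[f /andP[/eqP <- /existsP[j /eqP jk]]]].
have jl : (j <= len f)%N by apply: leq_trans (ltnW (ltn_ord j)) (entry_le f).
case: (W_disjoint kl jl (esym jk)) => [-> //|[w wk]].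
by have := nb w; rewrite wk.
Qed.

Lemma grid_label_inv q v : grid_label q = Some v ->
  block v q \/ exists2 e, s e = v & exists2 k, (k < entry e)%N & W e k = q.
Proof.
rewrite /grid_label; case: pickP => // u h [<-]; case/orP: h => [|]; first by left.
case/andP => _ /existsP[e /andP[/eqP se /existsP[k /eqP kq]]].
by right; exists e => //; exists k.
Qed.

Lemma grid_label_in q v : grid_label q = Some v -> in_grid q.
Proof. by case/grid_label_inv => [/block_in //|[e _ [k _ <-]]]. Qed.

Notation K := 'I_n.+2.
Notation Q := (K * K)%type.
Notation tS := (@torus_s n).
Notation tT := (@torus_t n).

(** All cells in use have coordinates between [1] and [n.+1], so the wrapping
    of the torus is not felt and its row and column zero stay free. *)
Definition cell (q : nat * nat) : Q := (inord q.1, inord q.2).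
Definition torus_label (q : Q) : option G := grid_label (val q.1, val q.2).

Lemma torus_label_cell q : in_grid q -> torus_label (cell q) = grid_label q.
Proof.
case: q => a b /andP[/andP[_ h1] /andP[_ h2]]; rewrite /torus_label /cell /=.
by rewrite !inordK.
Qed.

Lemma grid_edge_right p q : in_grid q ->
  (q == (p.1.+1, p.2)) || (q == (p.1, p.2.+1)) ->
  exists e, tS e = cell p /\ tT e = cell q.
Proof.
case: p q => a b q; rewrite /in_grid => /andP[/andP[_ h1] /andP[_ h2]] /orP[] /eqP E;
  rewrite E /= in h1 h2 *.
  exists (false, cell (a, b)); split => //; congr pair; apply: val_inj => /=.
    by rewrite !inordK ?ltnS // 1?ltnW // modnDmr addn1 modn_small ?ltnS.
  by rewrite inordK ?ltnS // addn0 modn_small ?ltnS.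
exists (true, cell (a, b)); split => //; congr pair; apply: val_inj => /=.
  by rewrite inordK ?ltnS // addn0 modn_small ?ltnS.
by rewrite !inordK ?ltnS // 1?ltnW // modnDmr addn1 modn_small ?ltnS.
Qed.

Lemma grid_edge p q : in_grid p -> in_grid q -> grid_adj p q ->
  exists e, (tS e, tT e) = (cell p, cell q) \/ (tS e, tT e) = (cell q, cell p).
Proof.
move=> hp hq /or4P h.
have : (q == (p.1.+1, p.2)) || (q == (p.1, p.2.+1)) \/
       (p == (q.1.+1, q.2)) || (p == (q.1, q.2.+1)).
  by case: h => ->; rewrite ?orbT; [left|left|right|right].
case => [/(grid_edge_right hq)|/(grid_edge_right hp)] [e [h1 h2]]; exists e.
  by left; rewrite h1 h2.
by right; rewrite h1 h2.
Qed.

Notation linked := (connect (inner_rel tS tT torus_label)).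

Lemma linked_step p q v : grid_label p = Some v -> grid_label q = Some v -> grid_adj p q ->
  linked (cell p) (cell q).
Proof.
move=> hp hq pq; have [ip iq] := (grid_label_in hp, grid_label_in hq).
have [e he] := grid_edge ip iq pq.
apply/connect1/existsP; exists e; apply/andP; split; last first.
  by case: he => ->; rewrite eqxx ?orbT.
by rewrite /inner; case: he => /pair_equal_spec[-> ->]; rewrite !torus_label_cell // hp hq eqxx.
Qed.

Lemma linked_block v q : block v q -> linked (cell (c v)) (cell q).
Proof.
have [m] := ubnP ((c v).1 - q.1 + (q.1 - (c v).1) + ((c v).2 - q.2 + (q.2 - (c v).2)))%N.
elim: m q => // m IH [a b] hm vq.
pose q' := (if a < (c v).1 then (a.+1, b) else
           if (c v).1 < a then (a.-1, b) else
           if b < (c v).2 then (a, b.+1) else (a, b.-1))%N.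
have [->|ne] := eqVneq (a, b) (c v); first exact: connect0.
have hne : ((a != (c v).1) || (b != (c v).2))%N.
  by move: ne; rewrite -negb_and; case: (c v).
have vq' : block v q'.
  move: vq; rewrite /grid_near /q' /=; case: (ltnP a (c v).1) => ?;
    last case: (ltnP (c v).1 a) => ?; last case: (ltnP b (c v).2) => ?;
  rewrite /=; lia.
have /connect_trans : linked (cell (c v)) (cell q').
  apply: IH vq'; move: hm; rewrite /q' /=; case: (ltnP a (c v).1) => ?;
    last case: (ltnP (c v).1 a) => ?; last case: (ltnP b (c v).2) => ?;
  rewrite /=; lia.
apply; apply: (@linked_step _ _ v); try exact: grid_label_block.
rewrite /q' /grid_adj; case: (ltnP a (c v).1) => ?;
    last case: (ltnP (c v).1 a) => ?; last case: (ltnP b (c v).2) => ?;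
  rewrite /= ?xpair_eqE /=; lia.
Qed.

Lemma linked_tail e k : (k < entry e)%N -> linked (cell (c (s e))) (cell (W e k)).
Proof.
elim: k => [|k IH] ke; first by rewrite W0 connect0.
apply: (connect_trans (IH (ltnW ke))).
case: (Wstep e k) => [->|]; first exact: connect0.
by apply: linked_step; apply: grid_label_tail => //; apply: ltnW.
Qed.

Lemma star_exists e : exists f,
  (torus_label (tS f) = Some (s e) /\ torus_label (tT f) = Some (t e)) \/
  (torus_label (tS f) = Some (t e) /\ torus_label (tT f) = Some (s e)).
Proof.
have e0 := entry_gt0 e.
have h1 : grid_label (W e (entry e).-1) = Some (s e) by apply: grid_label_tail; rewrite prednK.
have h2 : grid_label (W e (entry e)) = Some (t e) by apply: grid_label_block (entry_block e).
have : grid_adj (W e (entry e).-1) (W e (entry e)).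
  case: (Wstep e (entry e).-1); rewrite prednK // => E.
  by move: h1 (ends_neq e); rewrite E h2 => -[->]; rewrite eqxx.
case/(grid_edge (W_in _ _) (W_in _ _)) => f hf; exists f.
by case: hf => /pair_equal_spec[-> ->]; rewrite !torus_label_cell ?W_in // h1 h2; [left|right].
Qed.

Lemma lattice_has_maclane : has_maclane G.
Proof.
pose star e := sval (cid (star_exists e)).
have starP e : (torus_label (tS (star e)) = Some (s e) /\ torus_label (tT (star e)) = Some (t e)) \/
  (torus_label (tS (star e)) = Some (t e) /\ torus_label (tT (star e)) = Some (s e)).
  exact: (svalP (cid (star_exists e))).
have label_n0 q : torus_label q != None -> q.1 != 0 /\ q.2 != 0.
  case E : (torus_label q) => [v|] // _; have := grid_label_in E.
  by rewrite /in_grid /= => /andP[/andP[h1 _] /andP[h2 _]]; rewrite -!val_eqE /= -!lt0n.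
do 5!eexists; split; first exact: st.
apply: (@minor_maclane _ _ _ tS tT (@torus_l n) (@torus_r n) _ _ s t torus_label (fun v => cell (c v)) star).
- exact: torus_boundary_closed.
- move=> z zc zI; apply: torus_closed_boundary => // e /zI[/label_n0[? ?] /label_n0[? ?]].
  by split.
- move=> x [a b] labx.
  have -> : (a, b) = cell (val a, val b) by rewrite /cell /= !inord_val.
  by case: (grid_label_inv labx) => [/linked_block //|[e <- [k ke <-]]]; apply: linked_tail.
- move=> e f ef; apply: val_inj; rewrite !st.
  case: (starP e) (starP f) => -[h1 h2] [] [h3 h4]; move: h1 h2;
    rewrite ef h3 h4 => -[->] [->] //; exact: finset.setUC.
- exact: starP.
- exact: ends_neq.
Qed.

End LatticeModel.

(** * From plane drawings to the grid *)

Section PlaneSets.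
Import numFieldNormedType.Exports.
Local Open Scope classical_set_scope.

Variable R : realType.
Implicit Types (p q : R * R) (K C : set (R * R)).

Definition sup_near (d : R) p q : Prop := `|p.1 - q.1| < d /\ `|p.2 - q.2| < d.

Lemma ball_sup_near d p q : ball p d q = sup_near d p q.
Proof. by []. Qed.
(** Around each point of [K] a ball avoids [C]; compactness makes the radius
    uniform. *)
Lemma sup_near_sep K C : compact K -> closed C -> K `&` C = set0 ->
  \forall d \near 0^'+, forall p q, K p -> C q -> ~ sup_near d p q.
Proof.
move=> /compact_near_coveringP Kc Cc KC.
suff : \forall d \near 0^'+, K `<=` [set p | forall q, C q -> ~ sup_near d p q].
  by apply: filterS => d h p q /h; apply.
apply: Kc => p Kp.
have : nbhs p (~` C).
  apply: open_nbhs_nbhs; split; first exact: closed_openC.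
  by move=> Cp; have : (K `&` C) p by []; rewrite KC.
case/nbhs_ballP => e /= e0 eC.
exists (ball p (e / 2), [set d | d < e / 2]) => /=.
  split; first by apply: nbhsx_ballx; rewrite divr_gt0.
  by apply: nbhs_right_lt; rewrite divr_gt0.
move=> [q d] /= [pq dq] x Cx qx; apply: (eC x) Cx.
rewrite [e]splitr; apply: (ball_triangle pq).
by case: qx => h1 h2; split; apply: lt_trans dq.
Qed.

Lemma plane_hausdorff : hausdorff_space (R * R)%type.
Proof. exact: (@norm_hausdorff R (R * R)%type). Qed.

(** Uniform continuity on a compact interval. *)
Lemma sup_near_uniform (g : R -> R * R) (d : R) : 0 < d ->
  {within `[0, 1], continuous g} ->
  \forall e \near 0^'+, forall x y, 0 <= x <= 1 -> 0 <= y <= 1 ->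
    `|x - y| < e -> sup_near d (g x) (g y).
Proof.
move=> d0 gc.
have /compact_near_coveringP Kc := @segment_compact R 0 1.
suff : \forall e \near 0^'+, `[0, 1] `<=` [set x | 0 <= x <= 1 ->
    forall y, 0 <= y <= 1 -> `|x - y| < e -> sup_near d (g x) (g y)].
  by apply: filterS => e h x y xI; apply: h; rewrite /= ?in_itv.
apply: Kc => x xI.
have d2 : 0 < d / 2 by rewrite divr_gt0.
have /nbhs_ballP[e /= e0 he] : nbhs x (fun y => `[0, 1] y -> ball (g x) (d / 2) (g y)).
  move/subspace_continuousP: gc => /(_ x xI _ (nbhsx_ballx (g x) _ d2)).
  by [].
exists (ball x (e / 2), [set e' | e' < e / 2]) => /=.
  split; first by apply: nbhsx_ballx; rewrite divr_gt0.
  by apply: nbhs_right_lt; rewrite divr_gt0.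
move=> [y e'] /= [xy e'e] yI z zI yz.
have yb : ball x e y by apply: le_ball xy; rewrite ler_pdivrMr // ler_peMr ?ltW // ltrDl.
have zb : ball x e z.
  by rewrite [e]splitr; apply: (ball_triangle xy); apply: lt_trans e'e.
have hy := he y yb; have hz := he z zb.
rewrite -ball_sup_near [d]splitr; apply: (@ball_triangle _ _ (g x)).
  by apply: ball_sym; apply: hy; rewrite /= in_itv.
by apply: hz; rewrite /= in_itv.
Qed.
End PlaneSets.

Section Rounding.
Variables (R : realType) (N sh : nat) (B : R).
Hypothesis N0 : (0 < N)%N.

(** The shift by [B] makes all rounded quantities nonnegative, so that
    truncation is the floor function. *)
Definition round1 (x : R) : nat := (Num.truncn (N%:R * (x + B)) + sh)%N.
Definition round_pt (p : R * R) : nat * nat := (round1 p.1, round1 p.2).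

Lemma round1_near (j : nat) (x y : R) : `|x| <= B -> `|y| <= B ->
  `|x - y| < j%:R / N%:R -> (round1 x <= round1 y + j)%N.
Proof.
rewrite !ler_norml ltr_norml => /andP[x1 _] /andP[y1 _] /andP[_ xy].
have N0' : (0 < N%:R :> R) by rewrite ltr0n.
have hx : 0 <= N%:R * (x + B) by apply: mulr_ge0; [exact: ltW|lra].
have hy : 0 <= N%:R * (y + B) by apply: mulr_ge0; [exact: ltW|lra].
rewrite /round1 addnAC leq_add2r -ltnS truncn_lt_nat // -addSn natrD.
have /andP[_ h] := truncn_itv hy.
rewrite ltr_pdivlMr // in xy; move: h xy.
have hh (a b c : R) : c * (y + B) < a -> (x - y) * c < b -> c * (x + B) < a + b by nra.
exact: hh.
Qed.

Lemma near_round1 (j : nat) (x y : R) : `|x| <= B -> `|y| <= B ->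
  (round1 x <= round1 y + j)%N -> x - y < j.+1%:R / N%:R.
Proof.
rewrite !ler_norml => /andP[x1 _] /andP[y1 _].
have N0' : (0 < N%:R :> R) by rewrite ltr0n.
have hx : 0 <= N%:R * (x + B) by apply: mulr_ge0; [exact: ltW|lra].
have hy : 0 <= N%:R * (y + B) by apply: mulr_ge0; [exact: ltW|lra].
rewrite /round1 addnAC leq_add2r -ltnS truncn_lt_nat // -addnS natrD => h.
have /andP[h' _] := truncn_itv hy.
rewrite ltr_pdivlMr //; move: h h'.
have hh (a b c : R) : c * (x + B) < a + b -> a <= c * (y + B) -> (x - y) * c < b by nra.
exact: hh.
Qed.

Definition bounded_pt (p : R * R) := `|p.1| <= B /\ `|p.2| <= B.

Lemma round_near j p q : bounded_pt p -> bounded_pt q ->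
  sup_near (j%:R / N%:R) p q -> grid_near j (round_pt p) (round_pt q).
Proof.
move=> [p1 p2] [q1 q2] [h1 h2]; apply/and4P.
by split; apply: round1_near; rewrite // distrC.
Qed.

Lemma near_round j p q : bounded_pt p -> bounded_pt q ->
  grid_near j (round_pt p) (round_pt q) -> sup_near (j.+1%:R / N%:R) p q.
Proof.
move=> [p1 p2] [q1 q2] /and4P[h1 h2 h3 h4].
by split; rewrite ltr_norml ltrNl opprB !near_round1.
Qed.

End Rounding.

Lemma grid_near_sym k p q : grid_near k p q = grid_near k q p.
Proof. by rewrite /grid_near; lia. Qed.

Lemma grid_near_trans k j p q r : grid_near k p q -> grid_near j q r ->
  grid_near (k + j) p r.
Proof. by rewrite /grid_near; lia. Qed.

Lemma sup_near_weak (R : realType) (d d' : R) p q : d <= d' ->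
  sup_near d p q -> sup_near d' p q.
Proof. by move=> dd [h1 h2]; split; apply: lt_le_trans dd. Qed.

Lemma sup_near_sym (R : realType) (d : R) p q : sup_near d p q -> sup_near d q p.
Proof. by case=> h1 h2; split; rewrite distrC. Qed.

Lemma grid_near_adj p q : grid_near 1 p q -> (p.1 == q.1) || (p.2 == q.2) ->
  p = q \/ grid_adj p q.
Proof.
case: p q => a b [a' b'] /= ab eqab.
suff : ((a, b) == (a', b')) || grid_adj (a, b) (a', b').
  by case/orP => [/eqP|]; [left|right].
by move: ab eqab; rewrite /grid_adj /grid_near /= !xpair_eqE; lia.
Qed.

Section PlanarMaclane.
Import numFieldNormedType.Exports.
Variables (R : realType) (G : sgraph).
Local Open Scope classical_set_scope.

Lemma inv_nat_near0 (P : R -> Prop) : (\forall d \near 0^'+, P d) ->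
  exists2 m : nat, (0 < m)%N & forall m', (m <= m')%N -> P (m'%:R^-1).
Proof.
move=> [e /= e0 eP].
exists (Num.truncn e^-1).+1 => // m' mm'.
have em : e^-1 < m'%:R.
  by apply: lt_le_trans (truncnS_gt _) _; rewrite ler_nat.
have m0 : 0 < m'%:R :> R by apply: lt_trans em; rewrite invr_gt0.
apply: eP => /=; last by rewrite invr_gt0.
by rewrite sub0r normrN gtr0_norm ?invr_gt0 // invf_plt.
Qed.

(** Three scales are chosen in turn.  First [m]: within [4 / m] of a vertex
    there is no other vertex and no edge that does not end at it.  Then [k]: two
    edges are [1 / k] apart from each other outside the [1 / m]-neighbourhoods of
    the vertices, because curves meet only in common ends.  The grid has mesh
    [1 / N], with [N = 3 m k], so that [K = 3 k] steps of the grid make up [1 / m]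
    and three steps are at most [1 / k].  Finally, the arcs are sampled so finely
    that consecutive samples round to cells at distance at most one; inserting a
    corner between them turns the samples into walks.  As each cell of a walk is
    within one step of a rounded sample, blocks of radius [K + 1] meet all the
    requirements on a picture of [G] on the grid. *)
Lemma planar_has_maclane : planar R G -> has_maclane G.
Proof.
move=> [pos [curve [pos_inj arcs vtx cross]]].
have ends (e : edge_type G) : {p : G * G | adj p.1 p.2 /\ val e = [set p.1; p.2]%SET}.
  by apply: cid; have [x [y h]] := elimT (edgesP _) (valP e); exists (x, y).
pose s e := (sval (ends e)).1; pose t e := (sval (ends e)).2.
have st e : val e = [set s e; t e]%SET by case: (svalP (ends e)).
have arc (e : edge_type G) : {g : R -> R * R | [/\ {within `[0, 1], continuous g},
    g 0 = pos (s e), g 1 = pos (t e) & curve (val e) = g @` `[0, 1]]}.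
  apply: cid; have [h _] := svalP (ends e).
  by have [g [gc _ g0 g1 gE]] := arcs _ _ h; exists g; split; rewrite // st.
pose g e := sval (arc e).
have gc e : {within `[0, 1], continuous (g e)} by case: (svalP (arc e)).
have g0 e : g e 0 = pos (s e) by case: (svalP (arc e)).
have g1 e : g e 1 = pos (t e) by case: (svalP (arc e)).
have gE (e : edge_type G) : curve (val e) = g e @` `[0, 1] by case: (svalP (arc e)).
have gin (e : edge_type G) x : 0 <= x <= 1 -> curve (val e) (g e x).
  by move=> xI; rewrite gE; exists x; rewrite //= in_itv.
have cpt (e : edge_type G) : compact (curve (val e)).
  by rewrite gE; apply: continuous_compact => //; exact: segment_compact.
have ccl (e : edge_type G) : closed (curve (val e)) by apply: compact_closed (cpt e); exact: plane_hausdorff.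
have pcl v : closed [set pos v].
  by apply: compact_closed (@compact_set1 _ _); exact: plane_hausdorff.
have [B [Bv Bc]] : exists B, (forall v, bounded_pt B (pos v)) /\
    forall e : edge_type G, forall p, curve (val e) p -> bounded_pt B p.
  have cb (A : set (R * R)) : compact A ->
      \forall M \near +oo, forall p, A p -> bounded_pt M p.
    move/compact_bounded; rewrite /bounded_set /bounded_near.
    apply: filterS => M h p /h /=.
    by rewrite /Num.norm /= ge_max => /andP[].
  suff : \forall B \near +oo, (forall v, bounded_pt B (pos v)) /\
      forall e : edge_type G, forall p, curve (val e) p -> bounded_pt B p.
    by move/filter_ex.
  have hv : \forall B \near +oo, forall v, bounded_pt B (pos v).
    apply: filter_forall => v.
    by apply: filterS (cb _ (@compact_set1 _ (pos v))) => M; apply.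
  have he : \forall B \near +oo, forall e : edge_type G,
      forall p, curve (val e) p -> bounded_pt B p.
    by apply: filter_forall => e; exact: cb.
  exact: filterI hv he.
have Bg e x : 0 <= x <= 1 -> bounded_pt B (g e x) by move/(gin e)/Bc.
have sep : \forall d \near 0^'+,
   (forall u v, u != v -> ~ sup_near d (pos u) (pos v)) /\
   (forall (e : edge_type G) w p, w \notin val e -> curve (val e) p ->
      ~ sup_near d p (pos w)).
  have hv : \forall d \near 0^'+, forall u v, u != v -> ~ sup_near d (pos u) (pos v).
    apply: filter_forall => i; apply: filter_forall => j.
    have [->|ij] := eqVneq i j; first by apply: nearW => d /eqP.
    have : [set pos i] `&` [set pos j] = set0.
      by rewrite -subset0 => _ [/= -> /pos_inj] /eqP; rewrite (negPf ij).
    move/(sup_near_sep (@compact_set1 _ (pos i)) (pcl j)).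
    by apply: filterS => d h _; apply: h.
  suff he : \forall d \near 0^'+, forall (e : edge_type G) w p, w \notin val e ->
      curve (val e) p -> ~ sup_near d p (pos w) by exact: filterI hv he.
  apply: filter_forall => i; apply: filter_forall => j.
  have [ji|ji] := boolP (j \in val i); first by apply: nearW => d p.
  have : curve (val i) `&` [set pos j] = set0.
    by rewrite -subset0 => p [/= cp E]; move: cp ji; rewrite E => /(vtx _ _ (valP i)) ->.
  move/(sup_near_sep (cpt i) (pcl j)); apply: filterS => d h p _ cp; exact: h.
have [m0 m00 /(_ _ (leqnn _))[sepv sepe]] := inv_nat_near0 sep.
pose m := (4 * m0)%N.
have r0 : 0 < m%:R^-1 :> R by rewrite invr_gt0 ltr0n muln_gt0.
have far : \forall d \near 0^'+, forall (e f : edge_type G), e != f ->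
    forall p q, curve (val e) p -> (forall v, ~ sup_near m%:R^-1 (pos v) p) ->
    curve (val f) q -> ~ sup_near d p q.
  apply: filter_forall => e; apply: filter_forall => f.
  have [->|ef] := eqVneq e f; first by apply: nearW => d /eqP.
  pose away := \bigcap_(v in [set: G]) ~` ball (pos v) m%:R^-1.
  have away_cl : closed away.
    by apply: closed_bigI => v _; apply: open_closedC; apply: ball_open.
  have : (curve (val e) `&` away) `&` curve (val f) = set0.
    rewrite -subset0 => p [[ce aw] cf].
    have [|z zef zp] := cross _ _ (valP e) (valP f) _ p (conj ce cf).
      by rewrite (inj_eq val_inj).
    by have := aw z I; rewrite -zp /=; apply; apply: ballxx.
  move/(sup_near_sep (compact_closedI (cpt e) away_cl) (ccl f)).
  apply: filterS => d h _ p q ce aw cf; apply: h => //; split=> // v _; exact: aw.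
have [k k0 kP] := inv_nat_near0 far.
pose K := (3 * k)%N; pose N := (m * K)%N.
have N0 : (0 < N)%N by rewrite /N /K /m; lia.
have frac (a b : nat) : (0 < b)%N -> (a * b <= N)%N -> a%:R / N%:R <= b%:R^-1 :> R.
  move=> b0 abN; rewrite ler_pdivrMr ?ltr0n // mulrC ler_pdivlMr ?ltr0n //.
  by rewrite -natrM ler_nat.
(* The shift [sh] keeps the blocks away from coordinate zero. *)
pose rho := K.+1; pose sh := rho.+2.
pose rnd := round_pt N sh B.
have smooth : \forall d \near 0^'+, forall e x y, 0 <= x <= 1 -> 0 <= y <= 1 ->
    `|x - y| < d -> sup_near (1%:R / N%:R) (g e x) (g e y).
  apply: filter_forall => e; apply: sup_near_uniform (gc e).
  by rewrite divr_gt0 ?ltr0n.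
have [M0 M00 /(_ _ (leqnn _)) smoothM] := inv_nat_near0 smooth.
pose M := M0.+1.
pose tm a : R := (minn a M)%:R / M%:R.
have tmI a : 0 <= tm a <= 1.
  rewrite /tm divr_ge0 ?ler0n //= ler_pdivrMr ?ltr0n // mul1r ler_nat geq_minr //.
have tm_step a : `|tm a - tm a.+1| < M0%:R^-1.
  rewrite -mulrBl normrM [X in _ * X]ger0_norm ?invr_ge0 ?ler0n //.
  have h1 : `|(minn a M)%:R - (minn a.+1 M)%:R| <= 1 :> R.
    have : (minn a.+1 M == minn a M) || (minn a.+1 M == (minn a M).+1) by lia.
    case/orP => /eqP ->; first by rewrite subrr normr0.
    by rewrite -natr1 opprD addNKr normrN normr1.
  apply: (@le_lt_trans _ _ (1 * M%:R^-1)); first by rewrite ler_wpM2r ?invr_ge0 ?ler0n.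
  by rewrite mul1r ltf_pV2 ?posrE ?ltr0n // ltr_nat.
pose P e a := rnd (g e (tm a)).
have P0 e : P e 0 = rnd (pos (s e)) by rewrite /P /tm min0n mul0r g0.
have PM e : P e M = rnd (pos (t e)).
  by rewrite /P /tm minnn divff ?g1 // pnatr_eq0.
have Pstep e a : grid_near 1 (P e a) (P e a.+1).
  by apply: round_near => //; [exact: Bg|exact: Bg|exact: smoothM].
(* The odd steps are the corners between consecutive samples. *)
pose W e i := if odd i then ((P e i./2.+1).1, (P e i./2).2) else P e i./2.
have WP e i : grid_near 1 (W e i) (P e i./2).
  have := Pstep e i./2; rewrite /W; case: odd; rewrite /grid_near /=; lia.
have rnd_ge p : (sh <= (rnd p).1)%N /\ (sh <= (rnd p).2)%N by split; apply: leq_addl.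
pose n := (Num.truncn (N%:R * (B + B)) + sh + rho)%N.
have rnd_le p : bounded_pt B p -> ((rnd p).1 + rho <= n)%N /\ ((rnd p).2 + rho <= n)%N.
  have r1 (x : R) : `|x| <= B -> (round1 N sh B x + rho <= n)%N.
    rewrite ler_norml => /andP[_ xB]; rewrite !leq_add2r le_truncn //.
    by rewrite ler_wpM2l ?ler0n // lerD2r.
  by case=> /r1 ? /r1.
apply: (@lattice_has_maclane G s t st n rho (fun v => rnd (pos v)) (fun=> M.*2) W).
- move=> v q; have := rnd_le _ (Bv v); have := rnd_ge (pos v).
  rewrite /grid_near /in_grid /sh /rho; lia.
- move=> e i.
  have := rnd_ge (g e (tm i./2)); have := rnd_le _ (Bg e _ (tmI i./2)).
  have := rnd_ge (g e (tm i./2.+1)); have := rnd_le _ (Bg e _ (tmI i./2.+1)).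
  rewrite /W /in_grid /P /sh /rho; case: odd => /=; lia.
- by move=> e; rewrite /W /= P0.
- by move=> e; rewrite /W odd_double doubleK PM.
- move=> e i; have := Pstep e i./2.
  move=> Pi; apply: grid_near_adj; move: Pi; rewrite /W /= uphalf_half;
    case: (odd i) => /=; rewrite ?add0n ?add1n ?eqxx ?orbT //;
    by rewrite /grid_near /=; lia.
- move=> u v q uq; rewrite grid_near_sym => /(grid_near_trans uq).
  move/(near_round N0 (Bv u) (Bv v))/(sup_near_weak _) => near_uv.
  apply/eqP/contraT => /sepv; case; apply: near_uv; apply: frac => //.
  by rewrite /N /m /K /rho; nia.
- move=> e i w _ /grid_near_trans/(_ (WP e i)).
  move/(near_round N0 (Bv w) (Bg e _ (tmI i./2)))/(sup_near_weak _) => near_ew.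
  have [|we] := boolP (w \in val e).
    by rewrite st !inE => /orP[]/eqP; [left|right].
  case: (sepe e w _ we (gin e _ (tmI i./2))); apply: sup_near_sym.
  by apply: near_ew; apply: frac => //; rewrite /N /m /K /rho; nia.
- move=> e f i j _ _ ij.
  have [ef|ef] := eqVneq e f; [by left|right; apply: contrapT => nb].
  apply: (kP (m * k)%N _ e f ef _ _ (gin e _ (tmI i./2)) _ (gin f _ (tmI j./2))).
  + by rewrite leq_pmull // /m muln_gt0.
  + move=> v vp; apply: nb; exists v.
    rewrite /rho -addn1; apply: (@grid_near_trans _ _ _ (P e i./2)); last first.
      by rewrite grid_near_sym.
    apply: round_near (Bv v) (Bg e _ (tmI i./2)) _ => //.
    suff -> : K%:R / N%:R = m%:R^-1 :> R by [].
    rewrite /N natrM invfM mulrC -mulrA mulVf ?mulr1 // pnatr_eq0 /K; lia.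
  + have := WP e i; rewrite grid_near_sym ij => /grid_near_trans/(_ (WP f j)).
    move/(near_round N0 (Bg e _ (tmI i./2)) (Bg f _ (tmI j./2))).
    apply: sup_near_weak; apply: frac; rewrite /N /K /m; nia.
Qed.
End PlanarMaclane.

(** * Subgraphs, edge counts and triangles *)

Section HomPlanar.
Variables (R : realType) (G H : sgraph) (f : H -> G).
Hypothesis f_inj : injective f.
Hypothesis f_adj : forall x y, adj x y -> adj (f x) (f y).

Lemma imset_pair (x y : H) : (f @: [set x; y] = [set f x; f y])%SET.
Proof. by rewrite imsetU !imset_set1. Qed.

Lemma imset_edge (e : {set H}) : e \in edges H -> (f @: e)%SET \in edges G.
Proof. by case/edgesP => x [y [xy ->]]; rewrite imset_pair mem_edges f_adj. Qed.

Lemma planar_hom : planar R G -> planar R H.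
Proof.
move=> [pos [curve [pos_inj arcs vtx cross]]].
exists (pos \o f), (fun e : {set H} => curve (f @: e)%SET); split.
- exact: inj_comp.
- by move=> x y xy; rewrite imset_pair; apply/arcs/f_adj.
- move=> e z eH /(vtx _ _ (imset_edge eH)); by rewrite mem_imset.
- move=> e e' eH e'H ne p /cross[].
  + exact: imset_edge.
  + exact: imset_edge.
  + by rewrite (inj_eq (imset_inj f_inj)).
  + move=> z /=; rewrite inE => /andP[/imsetP[x xe ->] h] <-.
    by exists x => //=; rewrite inE xe -(mem_imset _ _ f_inj).
Qed.

End HomPlanar.

Section SubGraph.
Variables (G : sgraph) (U : {set G}) (c : rel G).
Hypothesis c_sym : symmetric c.

Definition sub_adj : rel {x : G | x \in U} :=
  fun x y => adj (val x) (val y) && c (val x) (val y).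

Lemma sub_adj_sym : symmetric sub_adj.
Proof. by move=> x y; rewrite /sub_adj adj_sym c_sym. Qed.

Lemma sub_adj_irr : irreflexive sub_adj.
Proof. by move=> x; rewrite /sub_adj adj_irr. Qed.

Definition sub_graph : sgraph := SGraph sub_adj_sym sub_adj_irr.

Lemma card_sub_graph : #|sub_graph| = #|U|.
Proof. by rewrite card_sig; apply: eq_card. Qed.

Lemma sub_graph_has_maclane (R : realType) (a : G) :
  planar R (delete_vertex a) -> a \notin U -> has_maclane sub_graph.
Proof.
move=> pl aU; apply: (@planar_has_maclane R).
have ne (x : sub_graph) : val x != a by apply: contraNneq aU => <-; apply: valP.
apply: (@planar_hom R (delete_vertex a) sub_graph (fun x => exist _ (val x) (ne x))).
- by move=> x y [/val_inj].
- by move=> x y /andP[].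
- exact: pl.
Qed.

End SubGraph.

Section Counting.
Variable G : sgraph.

(** Each edge is counted from both of its ends. *)
Lemma double_edges : (2 * #|edges G| = \sum_(x : G) \sum_(y : G) adj x y)%N.
Proof.
rewrite pair_bigA /=.
pose pr (u : G * G) := [set u.1; u.2]%SET.
transitivity (\sum_(u : G * G | adj u.1 u.2) 1)%N; last first.
  by rewrite big_mkcond /=; apply: eq_bigr => u _; case: adj.
rewrite (partition_big pr (fun e => e \in edges G)) /=; last first.
  by move=> [x y] /= xy; rewrite mem_edges.
rewrite mulnC -sum_nat_const; apply: eq_bigr => _ /edgesP[x [y [xy ->]]].
rewrite (eq_bigl (fun u => u \in [set (x, y); (y, x)]%SET)).
  by rewrite sum1_card cards2 xpair_eqE negb_and adj_neq.
have nxy := adj_neq xy.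
move=> [u v]; rewrite !inE /pr /= !xpair_eqE; apply/andP/orP.
  move=> [/adj_neq nuv /eqP E].
  have : u \in [set x; y]%SET by rewrite -E set21.
  have : v \in [set x; y]%SET by rewrite -E set22.
  rewrite !inE => /orP[]/eqP vE /orP[]/eqP uE; move: nuv; rewrite uE vE ?eqxx // => _;
    by [left|right].
case=> /andP[/eqP-> /eqP->]; first by rewrite xy eqxx.
by rewrite adj_sym xy finset.setUC.
Qed.

Lemma trianglesP (T : {set G}) : reflect
  (exists x y z, [/\ adj x y, adj y z, adj x z & T = [set x; y; z]%SET])
  (T \in triangles G).
Proof.
rewrite inE; apply: (iffP andP) => [[c3 /forall_inP h]|[x [y [z [xy yz xz ->]]]]].
  have /card_gt0P[x xT] : (0 < #|T|)%N by rewrite (eqP c3).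
  have : #|T :\ x|%SET == 2%N by move: c3; rewrite (cardsD1 x) xT.
  case/cards2P => y [z [yz E]].
  have [yT xy] : y \in T /\ y != x by move: (set21 y z); rewrite -E !inE => /andP[].
  have [zT xz] : z \in T /\ z != x by move: (set22 y z); rewrite -E !inE => /andP[].
  have ad u v : u \in T -> v \in T -> u != v -> adj u v.
    by move=> uT vT; apply/implyP; apply: (forall_inP (h u uT)).
  exists x, y, z; split; [|exact: ad| |]; try by apply: ad; rewrite 1?eq_sym.
  by rewrite -finset.setUA -E finset.setD1K.
have [[nxy nyz] nxz] := (adj_neq xy, adj_neq yz, adj_neq xz).
split; first by rewrite finset.setUC cardsU1 cards2 !inE nxy negb_or ![z == _]eq_sym nxz nyz.
apply/forall_inP => u; rewrite !inE -orbA => uT.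
apply/forall_inP => v; rewrite !inE -orbA => vT; apply/implyP.
case/or3P: uT => /eqP->; case/or3P: vT => /eqP->; rewrite ?eqxx //;
  by rewrite adj_sym.
Qed.

Lemma two_coloured_triangle_free (A : {set G}) :
  (forall x y, adj x y -> (x \in A) (+) (y \in A)) -> #|triangles G| = 0%N.
Proof.
move=> h; apply/eqP; rewrite cards_eq0 -finset.subset0; apply/fintype.subsetP => T.
by case/trianglesP => x [y [z [/h xy /h yz /h xz _]]]; move: xy yz xz; do 3!case: (_ \in A).
Qed.

End Counting.

Section SubCounting.
Variables (G : sgraph).

Definition induced (U : {set G}) : sgraph :=
  @sub_graph G U (fun _ _ => true) (fun _ _ => erefl).

Definition cut_rel (A : {set G}) : rel G := fun x y => (x \in A) (+) (y \in A).
Lemma cut_rel_sym A : symmetric (cut_rel A).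
Proof. by move=> x y; rewrite /cut_rel addbC. Qed.
Definition cut (U A : {set G}) : sgraph := sub_graph U (cut_rel_sym A).

Lemma double_edges_sub U c (cs : symmetric c) :
  (2 * #|edges (@sub_graph G U c cs)| =
   \sum_(x in U) \sum_(y in U) (adj x y && c x y))%N.
Proof.
rewrite double_edges [RHS]big_sub; apply: eq_bigr => x _.
by rewrite [RHS]big_sub.
Qed.

Lemma cut_triangle_free U A : #|triangles (cut U A)| = 0%N.
Proof.
apply: (@two_coloured_triangle_free (cut U A) [set x : cut U A | val x \in A]%SET) => x y.
by rewrite !inE => /andP[].
Qed.

Definition triangles_over (N X : {set G}) : {set {set G}} :=
  [set T in triangles G | T :\: N == X]%SET.

(** Each edge inside [N] forms a triangle with [c]. *)
Lemma apex_triangles (N : {set G}) c : c \notin N ->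
  (forall x, x \in N -> adj c x) ->
  (#|edges (induced N)| <= #|triangles_over N [set c]%SET|)%N.
Proof.
move=> cN cad.
pose f (e : {set induced N}) := (c |: [set val x | x in e])%SET.
have cim (e : {set induced N}) : c \notin [set val x | x in e]%SET.
  by apply: contra cN => /imsetP[x _ ->]; apply: valP.
rewrite -(card_imset (f := f)).
  apply/subset_leq_card/fintype.subsetP => _ /imsetP[e /edgesP[x [y [/andP[xy _] ->]]] ->].
  have fE : f [set x; y]%SET = [set c; val x; val y]%SET.
    by rewrite /f imsetU !imset_set1 finset.setUA.
  rewrite inE fE; apply/andP; split.
    by apply/trianglesP; exists c, (val x), (val y); split; rewrite ?cad ?(valP x) ?(valP y).
  apply/eqP/setP => z; rewrite !inE.
  case: (z =P c) => [->|_]; first by rewrite cN.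
  apply/negP => /andP[zN /orP[]/eqP E]; move: zN; rewrite E ?(valP x) ?(valP y) //.
move=> e e' /(congr1 (fun A => A :\ c)%SET); rewrite /f !setU1K //.
exact: (imset_inj val_inj).
Qed.

(** Grouping triangles by their part outside [N] keeps the families
    that are counted disjoint. *)
Lemma sum_triangles_over (N : {set G}) (s : seq {set G}) : uniq s ->
  (\sum_(X <- s) #|triangles_over N X| <= #|triangles G|)%N.
Proof.
move=> us; rewrite -[X in (_ <= X)%N]sum1_card.
rewrite [X in (_ <= X)%N](partition_big (fun T => T :\: N)%SET predT) //=.
rewrite [X in (X <= _)%N]big_uniq //=.
rewrite [X in (_ <= X)%N](bigID (mem s)) /= -[X in (X <= _)%N]addn0 leq_add //.
apply: leq_sum => X _; rewrite -sum1_card; apply: eq_leq; apply: eq_bigl => T.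
by rewrite inE.
Qed.

(** The triangles that avoid [a] lie in [G - a]; those through [a] come from
    the edges inside [N]. *)
Lemma triangles_split (N : {set G}) a : a \notin N -> (forall x, x \in N -> adj a x) ->
  (#|triangles (induced [set~ a]%SET)| + #|edges (induced N)| <= #|triangles G|)%N.
Proof.
move=> aN aad; pose A := [set T in triangles G | a \in T]%SET.
rewrite -(cardsID A) addnC leq_add //.
  apply: leq_trans (apex_triangles aN aad) _.
  apply/subset_leq_card/fintype.subsetP => T; rewrite inE => /andP[TG /eqP E].
  have aT : a \in T by move: (set11 a); rewrite -E inE => /andP[].
  by apply/finset.setIP; split; rewrite // finset.in_set TG aT.
rewrite -(card_imset (f := fun T : {set induced [set~ a]%SET} => val @: T)%SET).
  apply/subset_leq_card/fintype.subsetP => _ /imsetP[T TT ->].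
  case/trianglesP: TT => x [y [z [/andP[xy _] /andP[yz _] /andP[xz _] ->]]].
  have fE : (val @: [set x; y; z] = [set val x; val y; val z])%SET.
    by rewrite !imsetU !imset_set1.
  have ne (w : induced [set~ a]%SET) : (a == val w) = false.
    by have := valP w; rewrite !inE eq_sym => /negPf.
  apply/finset.setDP; split; rewrite fE.
    by apply/trianglesP; exists (val x), (val y), (val z).
  by rewrite finset.in_set negb_and !inE !ne orbT.
exact: (imset_inj val_inj).
Qed.
End SubCounting.

(** * The decomposition of an apex graph *)

Lemma sum_disjointU (T : finType) (A B : {set T}) (F : T -> nat) :
  [disjoint A & B] ->
  (\sum_(x in A :|: B) F x = \sum_(x in A) F x + \sum_(x in B) F x)%N.
Proof. by move=> AB; rewrite -bigU //; apply: eq_bigl => x; rewrite !inE. Qed.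

Section Links.
Variable G : sgraph.
Implicit Types A B C : {set G}.

Definition links A B : nat := (\sum_(x in A) \sum_(y in B) adj x y)%N.

Lemma linksC A B : links A B = links B A.
Proof.
rewrite /links exchange_big; apply: eq_bigr => x _; apply: eq_bigr => y _.
by rewrite adj_sym.
Qed.

Lemma linksUl A B C : [disjoint A & B] ->
  links (A :|: B)%SET C = (links A C + links B C)%N.
Proof. by move=> AB; rewrite /links sum_disjointU. Qed.

Lemma linksUr A B C : [disjoint A & B] ->
  links C (A :|: B)%SET = (links C A + links C B)%N.
Proof. by move=> AB; rewrite linksC linksUl // (linksC A) (linksC B). Qed.

(** The equality case detects complete bipartite pairs. *)
Lemma links_leqif A B :
  (links A B <= #|A| * #|B| ?= iff [forall x in A, forall y in B, adj x y])%N.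
Proof.
rewrite /links -sum_nat_const; apply: leqif_sum => x _.
rewrite -[#|B|]muln1 -sum_nat_const; apply: leqif_sum => y _.
by rewrite /leqif; case: adj.
Qed.

Lemma double_edges_links : (2 * #|edges G|)%N = links [set: G]%SET [set: G]%SET.
Proof.
rewrite double_edges /links; apply: eq_big => [x|x _]; first by rewrite inE.
by apply: eq_bigl => y; rewrite inE.
Qed.

Lemma double_edges_induced A : (2 * #|edges (induced A)|)%N = links A A.
Proof.
rewrite double_edges_sub; apply: eq_bigr => x _; apply: eq_bigr => y _.
by rewrite andbT.
Qed.

Lemma edges_cut A B : [disjoint A & B] -> #|edges (cut (A :|: B) A)| = links A B.
Proof.
move=> AB; apply: double_inj; rewrite -!mul2n double_edges_sub.
have nA x : x \in B -> (x \in A) = false by move=> xB; apply: disjointFl AB xB.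
rewrite sum_disjointU //= mul2n -addnn {2}linksC; congr (_ + _)%N.
  apply: eq_bigr => x xA; rewrite sum_disjointU //= big1 ?add0n => [|y yA].
    by apply: eq_bigr => y yB; rewrite /cut_rel xA nA // andbT.
  by rewrite /cut_rel xA yA andbF.
apply: eq_bigr => x xB; rewrite sum_disjointU //= [X in (_ + X)%N]big1 ?addn0 => [|y yB].
  by apply: eq_bigr => y yA; rewrite /cut_rel yA nA // andbT.
by rewrite /cut_rel !nA // andbF.
Qed.

End Links.

Lemma complete_bipartite_iso (G : sgraph) (A : {set G}) : #|A| = 3%N ->
  (forall x y, adj x y = (x \in A) (+) (y \in A)) ->
  isomorphic G (complete_bipartite 3 (#|G| - 3)).
Proof.
move=> cA adE.
have cC : (#|G| - 3)%N = #|~: A| by rewrite -cA -(cardsC A) addKn.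
pose g (i : complete_bipartite 3 (#|G| - 3)) : G := match i with
  | inl i => enum_val (cast_ord (esym cA) i)
  | inr i => enum_val (cast_ord cC i) end.
have gA i : (g i \in A) = (if i is inl _ then true else false).
  case: i => i; first exact: enum_valP.
  by have := enum_valP (cast_ord cC i); rewrite inE => /negPf.
have g_inj : injective g.
  move=> i j gij; have := gA i; rewrite gij gA.
  case: i j gij => [i|i] [j|j] //= /enum_val_inj/cast_ord_inj -> //.
have [|f gK fK] := inj_card_bij g_inj.
  rewrite card_sum !card_ord; have := max_card (mem A); lia.
exists f; first by exists g.
move=> x y; rewrite adE -{2}(fK x) -{2}(fK y) !gA.
by case: (f x) => ?; case: (f y) => ?.
Qed.

Section Apex.
Variables (R : realType) (G : sgraph) (a : G).
Hypothesis pl : planar R (delete_vertex a).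

Definition nbr : {set G} := [set x | adj a x]%SET.
Definition far : {set G} := (~: (a |: nbr))%SET.
Notation N := nbr.
Notation S := far.
Notation H := (induced [set~ a]%SET).

Lemma mem_nbr x : (x \in N) = adj a x.
Proof. by rewrite finset.in_set. Qed.

Lemma a_nbr : a \notin N.
Proof. by rewrite finset.in_set adj_irr. Qed.

Lemma a_far : a \notin S.
Proof. by rewrite finset.in_setC negbK finset.setU11. Qed.

Lemma nbr_far : [disjoint N & S].
Proof.
rewrite finset.disjoints_subset; apply/fintype.subsetP => x xN.
by rewrite finset.in_setC /far finset.in_setC negbK finset.in_setU xN orbT.
Qed.

Lemma nbr_far_cover : (N :|: S = [set~ a])%SET.
Proof.
apply/setP => x; rewrite /far !finset.in_setU !finset.in_setC !finset.in_setU !inE negb_or.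
by case: (x =P a) => [->|_]; rewrite ?adj_irr //= orbN.
Qed.

Lemma card_nbr_far : #|G| = (#|N| + #|S|).+1.
Proof.
have := cardsC1 a; have := max_card (mem [set a]%SET); rewrite cards1 => h.
rewrite -nbr_far_cover cardsU finset.disjoint_setI0 ?nbr_far // cards0 subn0.
move: h; rewrite -cardsT; lia.
Qed.

Lemma edges_delete : #|edges G| = (#|N| + #|edges H|)%N.
Proof.
apply: double_inj; rewrite -!mul2n mulnDr double_edges_links double_edges_induced.
have -> : [set: G]%SET = ([set a] :|: [set~ a])%SET.
  by apply/setP => x; rewrite !inE orbN.
have da : [disjoint [set a]%SET & [set~ a]%SET] by rewrite finset.disjoints_subset finset.setCK.
rewrite linksUl // !linksUr // -addnA [links [set~ a]%SET [set a]%SET]linksC.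
have -> : links [set a]%SET [set a]%SET = 0%N by rewrite /links !big_set1 adj_irr.
have -> : links [set a]%SET [set~ a]%SET = #|N|; last lia.
rewrite /links big_set1 -sum1_card big_mkcond [RHS]big_mkcond.
apply: eq_bigr => x _; rewrite finset.in_set !inE.
by case: (x =P a) => [->|_] /=; rewrite ?adj_irr //; case: adj.
Qed.

Lemma edges_rest :
  #|edges H| = (#|edges (induced N)| + #|edges (induced S)| + links N S)%N.
Proof.
apply: double_inj; rewrite -!mul2n !mulnDr !double_edges_induced -nbr_far_cover.
have d := nbr_far; rewrite linksUl // !linksUr // [links S N]linksC; lia.
Qed.

Lemma rest_bound : (5 <= #|G|)%N ->
  (2 * #|edges H| + 8 <= 4 * (#|N| + #|S|) + #|triangles H|)%N.
Proof.
move=> n4; have aU : a \notin [set~ a]%SET by rewrite !inE eqxx.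
have /maclane_triangle_bound : has_maclane H := sub_graph_has_maclane _ pl aU.
rewrite card_sub_graph -nbr_far_cover cardsU finset.disjoint_setI0 ?nbr_far // cards0 subn0.
by apply; rewrite card_nbr_far in n4.
Qed.

Lemma cut_bound : (5 <= #|G|)%N ->
  (links N S + 4 <= 2 * (#|N| + #|S|))%N.
Proof.
move=> n4; have aU : a \notin (N :|: S)%SET by rewrite nbr_far_cover !inE eqxx.
have /maclane_triangle_bound : has_maclane (cut (N :|: S) N).
  exact: sub_graph_has_maclane _ pl aU.
rewrite card_sub_graph cardsU finset.disjoint_setI0 ?nbr_far // cards0 subn0.
rewrite cut_triangle_free edges_cut ?nbr_far // card_nbr_far in n4 * => /(_ n4).
lia.
Qed.

Lemma far_bound : (3 <= #|S|)%N -> (#|edges (induced S)| + 6 <= 3 * #|S|)%N.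
Proof.
move=> s3; have /maclane_edge_bound : has_maclane (induced S).
  exact: sub_graph_has_maclane _ pl a_far.
by rewrite card_sub_graph; apply.
Qed.

End Apex.

Lemma links_pair (G : sgraph) (u v : G) : u != v ->
  links [set u; v]%SET [set u; v]%SET = (2 * adj u v)%N.
Proof.
move=> uv; have sum2 (F : G -> nat) :
    (\sum_(x in [set u; v]%SET) F x = F u + F v)%N.
  by rewrite big_setU1 ?big_set1 // inE.
by rewrite /links !sum2 !adj_irr [adj v u]adj_sym mul2n -addnn addn0.
Qed.

Lemma book_triangles (G : sgraph) (N : {set G}) (u v : G) :
  u \notin N -> v \notin N -> adj u v ->
  {in N, forall w, adj u w /\ adj v w} ->
  (#|N| <= #|triangles_over N [set u; v]%SET|)%N.
Proof.
move=> uN vN uv ad.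
rewrite -(card_in_imset (f := fun w => [set u; v; w]%SET)).
  apply/subset_leq_card/fintype.subsetP => _ /imsetP[w wN ->].
  have [uw vw] := ad w wN.
  rewrite finset.in_set; apply/andP; split; first by apply/trianglesP; exists u, v, w.
  apply/eqP/setP => z; rewrite !inE.
  case: (z =P u) => [->|_]; first by rewrite uN.
  case: (z =P v) => [->|_]; first by rewrite vN.
  by case: (z =P w) => [->|_]; rewrite ?wN ?andbF.
move=> w w' wN w'N /setP/(_ w); rewrite !inE eqxx !orbT.
case: (w =P u) => [E|_]; first by move: uN; rewrite -E wN.
case: (w =P v) => [E|_]; first by move: vN; rewrite -E wN.
by move=> /esym/= /eqP.
Qed.

Section ApexBounds.
Variables (R : realType) (G : sgraph) (a : G).
Hypothesis pl : planar R (delete_vertex a).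

Notation N := (nbr a).
Notation S := (far a).
Notation mN := #|edges (induced N)|.
Notation mS := #|edges (induced S)|.

Lemma edges_apex : #|edges G| = (#|N| + (mN + mS + links N S))%N.
Proof. by rewrite (edges_delete a) edges_rest. Qed.

Lemma far_edges_le : (2 * mS <= #|S| * #|S|)%N.
Proof. by rewrite double_edges_induced; case: (links_leqif S S). Qed.

Lemma cross_le : (links N S <= #|N| * #|S|)%N.
Proof. by case: (links_leqif N S). Qed.

Lemma cross_full : links N S = (#|N| * #|S|)%N ->
  forall x y, x \in N -> y \in S -> adj x y.
Proof.
case: (links_leqif N S) => _ h /eqP; rewrite h => /forall_inP g x y xN yS.
exact: (forall_inP (g x xN)).
Qed.

Lemma rest_far x : x != a -> x \notin N -> x \in S.
Proof. by move=> xa xN; rewrite finset.in_setC finset.in_setU1 negb_or xa. Qed.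

Lemma nbr_bipartition :
    (forall x y, x \in N -> y \in N -> adj x y = false) ->
    (forall x y, x \in S -> y \in S -> adj x y = false) ->
    links N S = (#|N| * #|S|)%N ->
  forall x y, adj x y = (x \in N) (+) (y \in N).
Proof.
move=> adNN adSS full.
have adNc x y : x \in N -> y \notin N -> adj x y.
  move=> xN yN; case: (eqVneq y a) => [->|ya]; first by rewrite adj_sym -mem_nbr.
  by apply: cross_full => //; apply: rest_far.
have adcc x y : x \notin N -> y \notin N -> adj x y = false.
  move=> xN yN; case: (eqVneq y a) => [->|ya].
    by rewrite adj_sym -mem_nbr (negPf xN).
  case: (eqVneq x a) => [->|xa]; first by rewrite -mem_nbr (negPf yN).
  by apply: adSS; apply: rest_far.
move=> x y; case: (boolP (x \in N)) => xN; case: (boolP (y \in N)) => yN /=.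
- exact: adNN.
- exact: adNc.
- by rewrite adj_sym adNc.
- exact: adcc.
Qed.

(** With [s = #|S|], three non-neighbours of [a] or more are dealt with by the
    planar bounds, through [few]; for [s <= 2] the hypothesis of [few] is checked
    by hand, except when [S] is a pair of adjacent vertices joined to all of [N].
    In that case each vertex of [N] spans a triangle with the pair, and each edge
    inside [N] spans three triangles, one with each of the other vertices. *)
Lemma apex_triangle_bound : (7 <= #|G|)%N ->
  (3 * #|edges G| + 27 <= 9 * #|G| + #|triangles G|)%N.
Proof.
move=> n7; have n5 : (5 <= #|G|)%N by apply: leq_trans n7.
have h1 := rest_bound pl n5; rewrite (edges_rest a) in h1.
have h2 : (#|triangles (induced [set~ a]%SET)| + mN <= #|triangles G|)%N.
  by apply: triangles_split (a_nbr a) _ => x; rewrite mem_nbr.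
rewrite (edges_apex); have h3 := cut_bound pl n5; have h4 := far_bound pl.
have h5 := far_edges_le; have h6 := cross_le.
have Vn := card_nbr_far a; rewrite Vn in n7 *.
have few : (links N S + mS + 10 <= 2 * (#|N| + #|S|) + 3 * #|S|)%N ->
    (3 * (#|N| + (mN + mS + links N S)) + 27 <=
     9 * (#|N| + #|S|).+1 + #|triangles G|)%N by lia.
have [s3|] := leqP 3 #|S|; first by have := h4 s3; lia.
rewrite ltnS leq_eqVlt ltnS => /orP[/eqP s2|s1]; last first.
  by apply: few; case: #|S| s1 h5 h6 n7 => [|[|//]] _; lia.
have /cards2P[u [v [uv E]]] : #|S| == 2%N by rewrite s2.
have mSE : mS = adj u v.
  have lSS : links S S = (2 * adj u v)%N by rewrite E links_pair.
  by have := double_edges_induced S; lia.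
have [/andP[uvadj /eqP full]|noex] := boolP (adj u v && (links N S == #|N| * #|S|)%N);
  last first.
  by apply: few; move: noex h6; rewrite mSE s2; case: (adj u v) => /=; lia.
have uS : u \in S by rewrite E set21.
have vS : v \in S by rewrite E set22.
have uN : u \notin N by rewrite (disjointFl (nbr_far a) uS).
have vN : v \notin N by rewrite (disjointFl (nbr_far a) vS).
have adN x : x \in S -> {in N, forall w, adj x w}.
  by move=> xS w wN; rewrite adj_sym; apply: cross_full.
have ka : (mN <= #|triangles_over N [set a]%SET|)%N.
  by apply: apex_triangles (a_nbr a) _ => x; rewrite mem_nbr.
have ku := apex_triangles uN (adN u uS).
have kv := apex_triangles vN (adN v vS).
have kuv : (#|N| <= #|triangles_over N [set u; v]%SET|)%N.
  by apply: book_triangles => // w wN; split; apply: adN.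
have au : a != u by apply: contraTneq uS => <-; exact: a_far.
have av : a != v by apply: contraTneq vS => <-; exact: a_far.
have := @sum_triangles_over G N
  [:: [set a]; [set u]; [set v]; [set u; v]]%SET.
rewrite !big_cons big_nil /= !inE !negb_or /= => tri.
have {}tri := tri _; rewrite mSE uvadj full s2.
have pair1 x y z : y != z -> ([set x] != [set y; z] :> {set G})%SET.
  by move=> yz; apply/eqP => /(congr1 (fun A : {set G} => #|A|)); rewrite cards1 cards2 yz.
have {tri} := tri; rewrite !(inj_eq finset.set1_inj) au av uv !pair1 //= => /(_ isT).
move: ka ku kv kuv n7; rewrite s2 addn0; clear.
move: #|N| mN #|triangles G| #|triangles_over _ _| #|triangles_over _ _|.
by move: #|triangles_over _ _| #|triangles_over _ _|; lia.
Qed.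

(** The neighbours of [a] are independent.  With three non-neighbours or more,
    the planar bound for triangle-free graphs suffices.  A single non-neighbour
    gives at most [2 (n - 1)] edges, too many only for [n = 4], where [N] is the
    side of three vertices.  If two non-neighbours are adjacent, each vertex
    of [N] is adjacent to at most one of them; if they are not, the excess
    forces all edges between [N] and [a |: S], which is the side of three
    vertices. *)
Lemma apex_triangle_free_bound : (5 <= #|G|)%N -> #|triangles G| = 0%N ->
  ~ isomorphic G (complete_bipartite 3 (#|G| - 3)) ->
  (#|edges G| <= 3 * #|G| - 10)%N.
Proof.
move=> n5 t0 niso.
have h1 := rest_bound pl n5; rewrite (edges_rest a) in h1.
have : (#|triangles (induced [set~ a]%SET)| + mN <= #|triangles G|)%N.
  by apply: triangles_split (a_nbr a) _ => x; rewrite mem_nbr.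
rewrite t0 leqn0 addn_eq0 => /andP[/eqP t'0 /eqP mN0].
rewrite t'0 mN0 in h1.
have Vn := card_nbr_far a.
have h5 := far_edges_le; have h6 := cross_le.
have notri (x y z : G) : adj x y -> adj y z -> adj x z -> False.
  move=> xy yz xz; have : [set x; y; z]%SET \in triangles G.
    by apply/trianglesP; exists x, y, z.
  by rewrite (cards0_eq t0) finset.in_set0.
have adNN x y : x \in N -> y \in N -> adj x y = false.
  by rewrite !mem_nbr => ax ay; apply/negP => xy; apply: notri ax xy ay.
rewrite edges_apex mN0 add0n.
have [s3|] := leqP 3 #|S|; first by move: n5; rewrite Vn; lia.
rewrite ltnS leq_eqVlt ltnS => /orP[/eqP s2|s1]; last first.
  case s : #|S| s1 => [|[|//]] _; first by rewrite s in h5 h6 Vn; lia.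
  have [full|nfull] := eqVneq (links N S) (#|N| * #|S|)%N; last by lia.
  have [n3|n3] := eqVneq #|N| 3%N; last by lia.
  case: niso; apply: (complete_bipartite_iso n3) => x y.
  apply: nbr_bipartition adNN _ full x y => z w.
  by have /eqP/cards1P[z0 ->] := s; rewrite !inE => /eqP-> /eqP->; apply: adj_irr.
have /cards2P[u [v [uv E]]] : #|S| == 2%N by rewrite s2.
have mSE : mS = adj u v.
  have lSS : links S S = (2 * adj u v)%N by rewrite E links_pair.
  by have := double_edges_induced S; lia.
have uS : u \in S by rewrite E set21.
have vS : v \in S by rewrite E set22.
case: (boolP (adj u v)) mSE => [uvadj|nuv] mSE.
  have : (links N S <= #|N|)%N.
    rewrite -sum1_card /links E; apply: leq_sum => x xN.
    rewrite big_setU1 ?big_set1 ?inE //=.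
    case: (boolP (adj x u)) => xu; case: (boolP (adj x v)) => xv //.
    by case: (notri x u v).
  by rewrite mSE; move: n5; rewrite Vn; lia.
have [full|nfull] := eqVneq (links N S) (#|N| * #|S|)%N; last first.
  by rewrite mSE; move: n5; rewrite Vn; lia.
have c3 : #|a |: S|%SET = 3%N by rewrite cardsU1 a_far s2.
case: niso; apply: (complete_bipartite_iso c3) => x y.
have nbrC z : (z \in a |: S)%SET = (z \notin N).
  rewrite finset.in_setU1; case: (eqVneq z a) => [->|za]; first by rewrite a_nbr.
  apply/idP/idP => [zS|]; last exact: rest_far.
  by rewrite (disjointFl (nbr_far a) zS).
rewrite !nbrC addNb addbN negbK; apply: nbr_bipartition adNN _ full x y => z w.
rewrite E !inE.
by do 2![case/orP => /eqP->]; rewrite ?adj_irr ?(negPf nuv) // adj_sym (negPf nuv).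
Qed.

End ApexBounds.

Theorem theorem1p9 (R : realType) :
  (forall G : sgraph,
     triangle_free G -> apex R G -> (5 <= #|G|)%N ->
     ~ isomorphic G (complete_bipartite 3 (#|G| - 3)) ->
     (#|edges G| <= 3 * #|G| - 10)%N)
  /\
  (forall (G : sgraph) (t : nat),
     apex R G -> (7 <= #|G|)%N -> #|triangles G| = t ->
     (#|edges G|%:R : rat) <= 3 * #|G|%:R - 9 + t%:R / 3).
Proof.
split=> [G t0 [a pl] n5|G t [a pl] n7 <-]; first exact: apex_triangle_free_bound pl n5 t0.
have := apex_triangle_bound pl n7.
rewrite -(ler_nat rat) natrD natrM [(9 * _ + _)%:R]natrD natrM; lra.
Qed.
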